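(* There exist constants $c>0$ and $c_1>0$, depending only on $d$ and $a$ (in particular independent of $k$, $m$, $L$ and $\bar\mu_0$), such that for every $f\in\mathcal L^\infty(\Omega)$ and every $x\in\Omega$, $$|(G_k(\Omega)f)(x)|\le c\,L^{2d}\,e^{-c_1\,\mathrm{dist}(x,\mathrm{supp} f)}\,\|f\|_\infty .$$
   Context: Standing setup. Fix an integer $d\ge1$, an odd integer $L>1$, integers $k\ge1$, $m\ge k$, and set $\eta=L^{-k}$. Let $\Omega=\eta\{0,1,\dots,L^m-1\}^d\subset\eta\mathbb Z^d$ and, for $0\le j\le m$, $\Omega_j=(L^j\eta)\{0,1,\dots,L^{m-j}-1\}^d$ (so $\Omega_k\subset\mathbb Z^d$ has unit spacing). For a finite set $O$ contained in a lattice of spacing $\epsilon$, $\mathcal L^2(O)$ denotes complex functions on $O$ with $\langle f,g\rangle=\epsilon^d\sum_{x\in O}\overline{f(x)}g(x)$, and $\|f\|_\infty=\max_{x}|f(x)|$. For $y\in (L^j\eta)\mathbb Z^d$ let $B_j(y)=\{x\in\eta\mathbb Z^d:\ y_\mu\le x_\mu<y_\mu+L^j\eta,\ \mu=0,\dots,d-1\}$; $\Omega$ is the disjoint union of the $B_j(y)$, $y\in\Omega_j$. The averaging operator $Q_{\Omega,j}:\mathcal L^2(\Omega)\to\mathcal L^2(\Omega_j)$ is $(Q_{\Omega,j}f)(y)=L^{-jd}\sum_{x\in B_j(y)}f(x)$; its adjoint is $(Q_{\Omega,j}^*h)(x)=h(y_x)$ where $y_x\in\Omega_j$ is the unique label with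 $x\in B_j(y_x)$. The Neumann Laplacian on $\Omega$ is $(\Delta^\eta_\Omega f)(x)=\eta^{-2}\sum_{\mu=0}^{d-1}\big(f(x+\eta e_\mu)-2f(x)+f(x-\eta e_\mu)\big)$, where any value $f(x\pm\eta e_\mu)$ with $x\pm\eta e_\mu\notin\Omega$ is replaced by $f(x)$ ($e_\mu$ the unit vectors). Fix $a\in(0,1]$ and set $a_j=a\frac{1-L^{-2}}{1-L^{-2j}}$ for $j\ge1$. Fix $\bar\mu_0\ge0$ and set $\bar\mu_j=L^{2j}\bar\mu_0$. Define $G_k(\Omega)=\big(-\Delta^\eta_\Omega+\bar\mu_k+a_kQ_{\Omega,k}^*Q_{\Omega,k}\big)^{-1}$ on $\mathcal L^2(\Omega)$. $|x-y|$ is the Euclidean distance and $\mathrm{dist}(x,S)=\min_{y\in S}|x-y|$. *)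

(* Defs.v *)
From mathcomp Require Import all_boot all_algebra.
From mathcomp Require Import all_classical all_reals all_analysis.
From mathcomp.real_closed Require Export complex.
Export GRing.Theory Num.Theory.

Set Implicit Arguments.
Unset Strict Implicit.
Unset Printing Implicit Defensive.

Local Open Scope ring_scope.

Section Defs.
Variable R : realType.
Local Notation C := R[i].

Definition toC (r : R) : C := Complex r 0.

(* Lattice points of Omega = eta {0,..,N-1}^d are represented by their
   integer coordinates n : 'I_d -> 'I_N; the physical point is eta * n. *)
Definition Pt (d N : nat) := {ffun 'I_d -> 'I_N}.

Definition eta (L k : nat) : R := ((L%:R : R)^-1) ^+ k.

Variables (d N : nat).

Definition nbr_plus (x : Pt d N) (mu : 'I_d) : option (Pt d N) :=
  omap (fun j : 'I_N => [ffun nu => if nu == mu then j else x nu])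
       (insub (x mu).+1).
Definition nbr_minus (x : Pt d N) (mu : 'I_d) : option (Pt d N) :=
  if (0 < x mu)%N then
    omap (fun j : 'I_N => [ffun nu => if nu == mu then j else x nu])
         (insub (x mu).-1)
  else None.

Definition nval (f : Pt d N -> C) (x : Pt d N) (o : option (Pt d N)) : C :=
  if o is Some y then f y else f x.

Definition neumann_lap (L k : nat) (f : Pt d N -> C) (x : Pt d N) : C :=
  toC (eta L k ^- 2) * \sum_(mu < d)
     (nval f x (nbr_plus x mu) - 2%:R * f x + nval f x (nbr_minus x mu)).

(* Averaging operator Q_{Omega,j}: labels y of Omega_j are represented by
   their integer block coordinates y : 'I_d -> nat (the block B_j(y) is the
   set of x with x_mu %/ L^j = y_mu for all mu). *)
Definition Qop (L j : nat) (f : Pt d N -> C) (y : 'I_d -> nat) : C :=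
  toC ((L%:R : R) ^- (j * d)) *
    \sum_(x : Pt d N | [forall mu, (x mu %/ L ^ j)%N == y mu]) f x.

Definition Qadj (L j : nat) (h : ('I_d -> nat) -> C) (x : Pt d N) : C :=
  h (fun mu => (x mu %/ L ^ j)%N).

Definition a_j (a : R) (L j : nat) : R :=
  a * (1 - (L%:R : R) ^- 2) / (1 - (L%:R : R) ^- (2 * j)).

Definition mubar_j (mu0 : R) (L j : nat) : R := (L%:R : R) ^+ (2 * j) * mu0.

Definition Aop (a mu0 : R) (L k : nat) (f : Pt d N -> C) (x : Pt d N) : C :=
  - neumann_lap L k f x + toC (mubar_j mu0 L k) * f x
  + toC (a_j a L k) * Qadj L k (Qop L k f) x.

Definition delta_fn (y : Pt d N) : Pt d N -> C :=
  fun x => if x == y then 1 else 0.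

Definition Amat (a mu0 : R) (L k : nat) : 'M[C]_#|{: Pt d N}| :=
  \matrix_(i, j) Aop a mu0 L k (delta_fn (enum_val j)) (enum_val i).

Definition Gk (a mu0 : R) (L k : nat) (f : Pt d N -> C) (x : Pt d N) : C :=
  \sum_(j < #|{: Pt d N}|) invmx (Amat a mu0 L k) (enum_rank x) j
                              * f (enum_val j).

Definition edist (L k : nat) (x y : Pt d N) : R :=
  eta L k * Num.sqrt (\sum_(mu < d) (((x mu)%:R : R) - ((y mu)%:R)) ^+ 2).

(* dist(x, supp f) = min over supp f.  The neutral element of the min is an
   upper bound of all distances from x, so for nonempty supp f this is the
   true minimum (for f = 0 both sides of the estimate vanish anyway). *)
Definition dist_supp (L k : nat) (x : Pt d N) (f : Pt d N -> C) : R :=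
  \big[Num.min/(\sum_(y : Pt d N) edist L k x y)]_(y : Pt d N | f y != 0)
     edist L k x y.

Definition supnorm (f : Pt d N -> C) : R :=
  \big[Num.max/0]_(x : Pt d N) ComplexField.Normc.normc (f x).

End Defs.

(* Main.v *)
Require Import Defs.
From mathcomp Require Import all_boot all_order all_algebra.
From mathcomp Require Import all_classical all_reals all_analysis.
From mathcomp.real_closed Require Import complex.
From mathcomp Require Import ring lra zify.
Import Order.TTheory GRing.Theory Num.Theory.
Set Implicit Arguments.
Unset Strict Implicit.
Unset Printing Implicit Defensive.
Local Open Scope ring_scope.

(** The averaging term [al Q^* Q] has positive off-diagonal entries, so the maximum principle
    argument does not apply to [A]; this forces the detour through [B], where that term counts as
    data. It can be so treated because averaging over a unit block gains exactly the factor [n^-d]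
    that turns the weighted L^2 bound into a pointwise one. The remaining term [B^-d u] must find
    the same gain in the kernel, and a kernel bound uniform in the spacing is obtained from one
    derivative in each of the [d] directions, hence [d] iterations. The summand 1 in [B] is a mass
    independent of [mu0] and pays for the growth of the weight. Hyperbolic cosines replace an
    exponential of the distance because they have no kink at [x0] and, with [x0] inside the box,
    only gain at the Neumann faces; so one family of weights serves both the energy estimate and the
    barrier. Half of the decay rate is spent on summing [1 / W] over a lattice of arbitrary
    volume. *)

(** Fix a point [x0] and the weight [W x = prod_mu 2 cosh (kappa (x_mu - x0_mu))]
    with [kappa] of order [a / d].  Testing [A u = f] against [u / W^2] and using
    the Poincare inequality on unit blocks bounds [u / W] in L^2 by [f / W], with
    constants independent of the lattice spacing (Combes-Thomas).  To pass from
    L^2 to sup norm, write [A u = f] as [B u = u + g] with [B = 1 + m2 - Laplacian]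
    and [g = f - al Q^* Q u], and iterate [d] times:
    [u = B^-d u + sum_(1 <= i <= d) B^-i g].  By the maximum principle [B^-1] is
    positive and maps [W] below [2 W], which handles the terms in [g].  The kernel
    of [B^-d] is bounded because the anisotropic Sobolev inequality controls
    [v(x)^2] by the form of [prod_mu (1 + lap mu)], which is dominated by [B^d];
    boundedness and positivity of the kernel give its weighted L^2 norm. *)

(** * The Neumann lattice: shifts, gradients, line averages *)

Section Lattice.
Variables (R : realType) (d N n : nat).
Local Notation T := (Pt d N).
Implicit Types (x y : T) (mu nu : 'I_d) (f g : T -> R).

Definition upd x mu (j : 'I_N) : T := [ffun nu => if nu == mu then j else x nu].

(** The default [j] at the end of a line is the Neumann rule: a missing neighbour takes the value at
    the point itself. *)
Definition osucc (j : 'I_N) : 'I_N := odflt j (insub j.+1).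
Definition opred (j : 'I_N) : 'I_N := odflt j (insub j.-1).

Definition sp mu x := upd x mu (osucc (x mu)).
Definition sm mu x := upd x mu (opred (x mu)).

(** Read [n] as [1 / eta]. The sign is that of minus the Laplacian, so [lap] is a nonnegative
    operator. *)
Definition lap mu f x := n%:R ^+ 2 * (2 * f x - f (sp mu x) - f (sm mu x)).
Definition grad mu f x := n%:R * (f (sp mu x) - f x).
Definition avg mu f x :=
  n%:R^-1 * \sum_(j < N | (j %/ n == x mu %/ n)%N) f (upd x mu j).

Lemma val_osucc j : osucc j = (if (j.+1 < N)%N then j.+1 else j) :> nat.
Proof. by rewrite /osucc; case: insubP => [k -> ->|/negbTE ->]. Qed.

Lemma val_opred j : opred j = j.-1 :> nat.
Proof.
by rewrite /opred; case: insubP => [k _ ->|] //; rewrite (leq_ltn_trans (leq_pred j)).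
Qed.

Lemma upd_same x mu j : upd x mu j mu = j.
Proof. by rewrite ffunE eqxx. Qed.

Lemma upd_other x mu nu j : nu != mu -> upd x mu j nu = x nu.
Proof. by move=> /negbTE h; rewrite ffunE h. Qed.

Lemma upd_id x mu : upd x mu (x mu) = x.
Proof. by apply/ffunP => nu; rewrite ffunE; case: eqP => [->|]. Qed.

Lemma upd_upd x mu i j : upd (upd x mu i) mu j = upd x mu j.
Proof. by apply/ffunP => nu; rewrite !ffunE; case: eqP. Qed.

Lemma upd_comm x mu nu i j : mu != nu ->
  upd (upd x mu i) nu j = upd (upd x nu j) mu i.
Proof.
move=> h; apply/ffunP => k; rewrite !ffunE.
by case: eqP => [->|//]; rewrite eq_sym (negbTE h).
Qed.

Lemma sp_upd x mu nu j : mu != nu -> sp mu (upd x nu j) = upd (sp mu x) nu j.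
Proof. by move=> h; rewrite /sp upd_other // upd_comm // eq_sym. Qed.

Lemma sp_other x mu nu : nu != mu -> sp mu x nu = x nu.
Proof. exact: upd_other. Qed.

Lemma sp_sp x mu nu : mu != nu -> sp mu (sp nu x) = sp nu (sp mu x).
Proof. by move=> h; rewrite /sp !upd_other 1?upd_comm // eq_sym. Qed.

Lemma sp_sm x mu nu : mu != nu -> sp mu (sm nu x) = sm nu (sp mu x).
Proof. by move=> h; rewrite /sp /sm !upd_other 1?upd_comm // eq_sym. Qed.

Lemma sm_sm x mu nu : mu != nu -> sm mu (sm nu x) = sm nu (sm mu x).
Proof. by move=> h; rewrite /sm !upd_other 1?upd_comm // eq_sym. Qed.

Lemma lap_lap mu nu f : lap mu (lap nu f) = lap nu (lap mu f).
Proof.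
case: (eqVneq mu nu) => [->//|h]; apply/funext => x; rewrite /lap.
have h' : nu != mu by rewrite eq_sym.
by rewrite (sp_sp x h) (sm_sm x h) (sp_sm x h) (sp_sm x h'); ring.
Qed.

Lemma grad_lap mu nu f : mu != nu -> grad mu (lap nu f) = lap nu (grad mu f).
Proof.
move=> h; apply/funext => x; rewrite /lap /grad.
by rewrite (sp_sp x h) (sp_sm x h); ring.
Qed.

Lemma grad_avg mu nu f : mu != nu -> grad mu (avg nu f) = avg nu (grad mu f).
Proof.
move=> h; apply/funext => x; rewrite /avg /grad sp_other; last by rewrite eq_sym.
rewrite -mulrBr -sumrB mulrCA -mulr_sumr; congr (_ * (_ * _)).
by apply: eq_bigr => j _; rewrite sp_upd.
Qed.

Lemma lapD mu f g : lap mu (f \+ g) = lap mu f \+ lap mu g.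
Proof. by apply/funext => x; rewrite /lap /=; ring. Qed.

Lemma lapZ mu (c : R) f : lap mu (fun x => c * f x) = (fun x => c * lap mu f x).
Proof. by apply/funext => x; rewrite /lap /=; ring. Qed.

Lemma avgD mu f g : avg mu (f \+ g) = avg mu f \+ avg mu g.
Proof. by apply/funext => x; rewrite /avg /= big_split /= mulrDr. Qed.

Lemma avgZ mu (c : R) f : avg mu (fun x => c * f x) = (fun x => c * avg mu f x).
Proof. by apply/funext => x; rewrite /avg -mulr_sumr mulrCA. Qed.

Lemma le_avg mu f g x : (forall y, f y <= g y) -> avg mu f x <= avg mu g x.
Proof.
by move=> h; rewrite /avg ler_wpM2l ?invr_ge0 ?ler0n //; apply: ler_sum => *.
Qed.

Lemma sp_sm_id mu x : (0 < x mu)%N -> sp mu (sm mu x) = x.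
Proof.
move=> h; rewrite /sp /sm upd_upd upd_same; apply: etrans (upd_id x mu); congr (upd x mu _).
apply/val_inj => /=; rewrite val_osucc val_opred prednK //.
by rewrite ltn_ord.
Qed.

Lemma sm_sp_id mu x : ((x mu).+1 < N)%N -> sm mu (sp mu x) = x.
Proof.
move=> h; rewrite /sp /sm upd_upd upd_same; apply: etrans (upd_id x mu); congr (upd x mu _).
by apply/val_inj => /=; rewrite val_opred val_osucc h.
Qed.

Lemma sp_top mu x : ~~ ((x mu).+1 < N)%N -> sp mu x = x.
Proof.
move=> h; rewrite /sp; apply: etrans (upd_id x mu); congr (upd x mu _).
by apply/val_inj => /=; rewrite val_osucc (negbTE h).
Qed.

Lemma sm_bot mu x : ~~ (0 < x mu)%N -> sm mu x = x.
Proof.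
move=> h; rewrite /sm; apply: etrans (upd_id x mu); congr (upd x mu _).
by apply/val_inj => /=; rewrite val_opred; case: (nat_of_ord _) h.
Qed.

(* Both sides run over the nearest-neighbour bonds in direction [mu]. *)
Lemma sum_bonds mu (phi : T -> T -> R) : (forall x, phi x x = 0) ->
  \sum_x phi x (sm mu x) = \sum_x phi (sp mu x) x.
Proof.
move=> phi0; rewrite (bigID (fun x : T => 0 < x mu)%N) /= [X in _ + X]big1 ?addr0; last first.
  by move=> x /sm_bot ->.
rewrite [RHS](bigID (fun x : T => (x mu).+1 < N)%N) /= [X in _ = _ + X]big1 ?addr0; last first.
  by move=> x /sp_top ->.
rewrite (reindex_onto (sp mu) (sm mu)) /=; last by move=> x; exact: sp_sm_id.
apply: eq_big => [x|x /andP[_ /eqP ->]] //.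
rewrite upd_same val_osucc; case: (ltnP (x mu).+1 N) => h; first by rewrite (sm_sp_id h) eqxx.
rewrite sp_top -?leqNgt //; apply/negbTE/negP => /andP[h0 /eqP /(congr1 (fun y : T => val (y mu)))].
rewrite /sm upd_same /= val_opred => e.
by move: (ltnn (x mu)); rewrite -{1}e prednK ?leqnn.
Qed.

(** The two one-sided halves of [lap] are carried by the same bonds, and a clamped neighbour
    contributes zero, so no boundary term appears. *)
Lemma lap_ibp mu f g : \sum_x f x * lap mu g x = \sum_x grad mu f x * grad mu g x.
Proof.
have -> : \sum_x f x * lap mu g x =
   \sum_x f x * n%:R ^+ 2 * (g x - g (sp mu x)) + \sum_x f x * n%:R ^+ 2 * (g x - g (sm mu x)).
  by rewrite -big_split /=; apply: eq_bigr => x _; rewrite /lap; ring.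
rewrite (sum_bonds mu (phi := fun x y => f x * n%:R ^+ 2 * (g x - g y))); last first.
  by move=> x; rewrite subrr mulr0.
by rewrite -big_split /=; apply: eq_bigr => x _; rewrite /grad; ring.
Qed.

Lemma lap_sym mu f g : \sum_x f x * lap mu g x = \sum_x lap mu f x * g x.
Proof.
rewrite lap_ibp; under [RHS]eq_bigr do rewrite mulrC.
by rewrite lap_ibp; apply: eq_bigr => x _; rewrite mulrC.
Qed.

End Lattice.

(** * Inequalities on a line of a block *)

Section FiniteSums.
Variables (R : realType) (I : finType).
Implicit Types (P Q : pred I) (a b : I -> R).

Lemma ler_sum_sub P Q a : (forall i, P i -> Q i) -> (forall i, 0 <= a i) ->
  \sum_(i | P i) a i <= \sum_(i | Q i) a i.
Proof.
move=> PQ a0; rewrite [leLHS]big_mkcond [leRHS]big_mkcond /=; apply: ler_sum => i _.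
by case: (boolP (P i)) => [/PQ ->//|_]; case: ifP.
Qed.

Lemma sqr_sum_le P a :
  (\sum_(i | P i) a i) ^+ 2 <= (\sum_(i | P i) 1) * \sum_(i | P i) a i ^+ 2.
Proof.
set c := \sum_(i | P i) 1; set S := \sum_(i | P i) a i; set V := \sum_(i | P i) _.
have c0 : 0 <= c by apply: sumr_ge0.
have h : 0 <= c * (c * V - S ^+ 2).
  have -> : c * (c * V - S ^+ 2) = \sum_(i | P i) (c * a i - S) ^+ 2.
    rewrite (eq_bigr (fun i => c ^+ 2 * (a i ^+ 2) +
      (- (2 * c * S) * a i + S ^+ 2 * 1))); last by move=> i _; ring.
    by rewrite !big_split /= -!mulr_sumr -/S -/V -/c; ring.
  by apply: sumr_ge0 => *; exact: sqr_ge0.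
case: (ltrP 0 c) => [cp|cn]; first by rewrite -subr_ge0 -(pmulr_rge0 _ cp).
have P0 i : P i -> False.
  move=> Pi; have : 1 <= c by rewrite /c (bigD1 i) //= lerDl; apply: sumr_ge0.
  by lra.
rewrite /S big_pred0 => [|i]; last by apply/negP => /P0.
by rewrite expr0n /= mulr_ge0 // /V; apply: sumr_ge0 => *; exact: sqr_ge0.
Qed.

Lemma cauchy_schwarz a b :
  (\sum_i a i * b i) ^+ 2 <= (\sum_i a i ^+ 2) * (\sum_i b i ^+ 2).
Proof.
set X := \sum_i a i * b i; set U := \sum_i a i ^+ 2; set V := \sum_i b i ^+ 2.
have h : 0 <= V * (U * V - X ^+ 2).
  have -> : V * (U * V - X ^+ 2) = \sum_i (V * a i - X * b i) ^+ 2.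
    rewrite (eq_bigr (fun i => V ^+ 2 * (a i ^+ 2) +
      (- (2 * V * X) * (a i * b i) + X ^+ 2 * b i ^+ 2))); last by move=> i _; ring.
    by rewrite !big_split /= -!mulr_sumr -/U -/V -/X; ring.
  by apply: sumr_ge0 => *; exact: sqr_ge0.
have V0 : 0 <= V by apply: sumr_ge0 => *; exact: sqr_ge0.
case: (ltrP 0 V) => [Vp|Vn]; first by rewrite -subr_ge0 -(pmulr_rge0 _ Vp).
have b0 i : b i = 0.
  have : b i ^+ 2 <= 0.
    by apply: le_trans Vn; rewrite /V (bigD1 i) //= lerDl; apply: sumr_ge0 => *; exact: sqr_ge0.
  by move=> h2; apply/eqP; rewrite -sqrf_eq0; apply/eqP/le_anti; rewrite h2 sqr_ge0.
rewrite /X big1 => [|i _]; last by rewrite b0 mulr0.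
by rewrite expr0n /= mulr_ge0 // /U; apply: sumr_ge0 => *; exact: sqr_ge0.
Qed.

End FiniteSums.

Section Line.
Variables (R : realType) (N n : nat).
Hypotheses (n_gt0 : (0 < n)%N) (n_dvd : (n %| N)%N).
Implicit Types (i j l : 'I_N) (g : 'I_N -> R).

(** Divisibility of [N] by [n] excludes a truncated last block; a block is then parametrized by
    remainders. *)
Lemma sum_block1 i : \sum_(j < N | (j %/ n == i %/ n)%N) (1 : R) = n%:R.
Proof.
have pf (r : 'I_n) : (i %/ n * n + r < N)%N.
  have [M eN] := dvdnP n_dvd.
  have : (i %/ n < M)%N by rewrite ltn_divLR // -eN.
  move=> h; apply: (@leq_trans ((i %/ n).+1 * n)); last by rewrite [leqRHS]eN leq_mul2r h orbT.
  by rewrite mulSn addnC ltn_add2r.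
rewrite (reindex_onto (fun r => Ordinal (pf r)) (fun j : 'I_N => Ordinal (ltn_pmod j n_gt0))) /=; last first.
  by move=> j /eqP e; apply/val_inj; rewrite /= -e -divn_eq.
under eq_bigl => r.
  rewrite divnMDl // (divn_small (ltn_ord r)) addn0 eqxx /=.
  rewrite (_ : Ordinal _ = r) ?eqxx; last by apply/val_inj; rewrite /= modnMDl modn_small.
  over.
by rewrite sumr_const card_ord.
Qed.

Lemma sum_block_const i (c : R) :
  \sum_(j < N | (j %/ n == i %/ n)%N) c = n%:R * c.
Proof. by rewrite -(sum_block1 i) mulr_suml; apply: eq_bigr => *; rewrite mul1r. Qed.

Lemma path_le g i j : (i <= j)%N ->
  `|g j - g i| <= \sum_(l < N | (i <= l < j)%N) `|g (osucc l) - g l|.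
Proof.
move=> ij; rewrite -(subnKC ij); move e: (j - i)%N => k.
have {ij e} : (j = i + k :> nat)%N by lia.
elim: k j => [|k IH] j e.
  have -> : j = i by apply/val_inj; rewrite /= e addn0.
  by rewrite subrr normr0 sumr_ge0.
have hj : opred j = (i + k)%N :> nat by rewrite val_opred e addnS.
have -> : j = osucc (opred j).
  apply/val_inj; rewrite /= val_osucc val_opred e addnS /=.
  by rewrite ifT // -addnS -e.
rewrite (bigD1 (opred j)) /=; last by rewrite hj addnS leqnn leq_addr.
apply: le_trans (_ : `|g (osucc (opred j)) - g (opred j)| + `|g (opred j) - g i| <= _).
  by apply: le_trans (ler_normD _ _); rewrite addrA subrK.
rewrite lerD2l; apply: le_trans (IH _ hj) _; apply: ler_sum_sub => // l /andP[h1 h2].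
by apply/andP; split; [lia | apply/eqP => /(congr1 (@nat_of_ord N)); lia].
Qed.

(** The sum includes the bond that leaves the block. This harmless overcount allows the later bounds
    to use the global [grad]. *)
Lemma block_osc g i j : (i %/ n = j %/ n)%N ->
  `|g j - g i| <= \sum_(l < N | (l %/ n == i %/ n)%N) `|g (osucc l) - g l|.
Proof.
wlog ij : i j / (i <= j)%N => [H e|e].
  case: (leqP i j) => [/H|/ltnW /H]; first exact.
  by move=> /(_ (esym e)); rewrite distrC e.
apply: le_trans (path_le _ ij) _; apply: ler_sum_sub => // l /andP[h1 h2].
by rewrite eqn_leq {1}e !leq_div2r // ltnW.
Qed.

(** On the block [g] deviates from its mean by at most the total variation [Z], and Cauchy-Schwarz
    bounds [Z^2] by the averaged squared gradient. A block has unit physical length, hence the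
    constant 1 for every [n]. *)
Lemma line_poincare g i :
  n%:R^-1 * \sum_(j < N | (j %/ n == i %/ n)%N) g j ^+ 2 <=
  (n%:R^-1 * \sum_(j < N | (j %/ n == i %/ n)%N) g j) ^+ 2 +
  n%:R^-1 * \sum_(j < N | (j %/ n == i %/ n)%N) (n%:R * (g (osucc j) - g j)) ^+ 2.
Proof.
set m := n%:R^-1 * \sum_(j < N | _) g j.
set Z := \sum_(l < N | (l %/ n == i %/ n)%N) `|g (osucc l) - g l|.
have np : 0 < n%:R :> R by rewrite ltr0n.
have nz : n%:R != 0 :> R by rewrite gt_eqF.
have osc j : (j %/ n == i %/ n)%N -> (g j - m) ^+ 2 <= Z ^+ 2.
  move=> bj; rewrite -real_normK ?num_real // ler_pXn2r ?nnegrE ?normr_ge0 //; last exact: sumr_ge0.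
  have -> : g j - m = n%:R^-1 * \sum_(l < N | (l %/ n == i %/ n)%N) (g j - g l).
    rewrite sumrB /m mulrBr; congr (_ - _).
    by rewrite sum_block_const mulKf.
  rewrite normrM gtr0_norm ?invr_gt0 // ler_pdivrMl //.
  apply: le_trans (ler_norm_sum _ _ _) _.
  rewrite -(sum_block1 i) mulr_suml; apply: ler_sum => l bl; rewrite mul1r.
  rewrite /Z -(eqP bl); apply: block_osc.
  by rewrite (eqP bl) (eqP bj).
have Z2 : Z ^+ 2 <= n%:R * \sum_(j < N | (j %/ n == i %/ n)%N) (g (osucc j) - g j) ^+ 2.
  rewrite /Z; apply: le_trans (sqr_sum_le _ _) _; rewrite sum_block1.
  rewrite ler_wpM2l ?ler0n //; apply: ler_sum => l _.
  by rewrite real_normK ?num_real.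
have : \sum_(j < N | (j %/ n == i %/ n)%N) (g j - m) ^+ 2 <= n%:R * Z ^+ 2.
  by rewrite -(sum_block1 i) mulr_suml; apply: ler_sum => j bj; rewrite mul1r osc.
have -> : \sum_(j < N | (j %/ n == i %/ n)%N) (g j - m) ^+ 2 =
    \sum_(j < N | (j %/ n == i %/ n)%N) g j ^+ 2 - n%:R * m ^+ 2.
  rewrite (eq_bigr (fun j => g j ^+ 2 + (- (2 * m) * g j + m ^+ 2 * 1))); last by move=> j _; ring.
  rewrite !big_split /= -!mulr_sumr sum_block1.
  have -> : \sum_(j < N | (j %/ n == i %/ n)%N) g j = n%:R * m by rewrite /m mulrA divff ?mul1r.
  by ring.
move=> h; rewrite mulrC ler_pdivrMr // mulrDl.
have -> : n%:R^-1 * (\sum_(j < N | (j %/ n == i %/ n)%N) (n%:R * (g (osucc j) - g j)) ^+ 2) * n%:R =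
   n%:R ^+ 2 * \sum_(j < N | (j %/ n == i %/ n)%N) (g (osucc j) - g j) ^+ 2.
  rewrite mulrAC mulVf // mul1r mulr_sumr.
  by apply: eq_bigr => j _; rewrite exprMn.
have := ler_wpM2l (ltW np) Z2; nra.
Qed.

(** Discrete form of integrating the derivative [2 g g'] of [g^2]: the oscillation of [g^2] over the
    block is at most [Y], and averaging over the second endpoint [j] gives the bound. *)
Lemma line_sobolev g i :
  g i ^+ 2 <= 2 * (n%:R^-1 * \sum_(j < N | (j %/ n == i %/ n)%N)
                     (g j ^+ 2 + (n%:R * (g (osucc j) - g j)) ^+ 2)).
Proof.
have np : 0 < n%:R :> R by rewrite ltr0n.
have nz : n%:R != 0 :> R by rewrite gt_eqF.
have n1 : 1 <= n%:R :> R by rewrite ler1n.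
pose dlt j := n%:R * (g (osucc j) - g j).
have edlt j : g (osucc j) = g j + n%:R^-1 * dlt j by rewrite /dlt mulKf // addrC subrK.
set Y := \sum_(l < N | (l %/ n == i %/ n)%N) n%:R^-1 * (g l ^+ 2 + 2 * dlt l ^+ 2).
have h j : (j %/ n == i %/ n)%N -> g i ^+ 2 <= g j ^+ 2 + Y.
  move=> bj; rewrite -lerBlDl; apply: le_trans (ler_norm _) _.
  apply: le_trans (block_osc (fun l => g l ^+ 2) (eqP bj)) _.
  rewrite (eqP bj); apply: ler_sum => l _; rewrite edlt.
  have -> : (g l + n%:R^-1 * dlt l) ^+ 2 - g l ^+ 2 =
     n%:R^-1 * (2 * g l * dlt l + n%:R^-1 * dlt l ^+ 2) by ring.
  rewrite normrM gtr0_norm ?invr_gt0 // ler_pM2l ?invr_gt0 //.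
  have v1 : n%:R^-1 <= 1 :> R by rewrite invf_le1.
  have v0 : 0 <= n%:R^-1 :> R by rewrite invr_ge0 ler0n.
  have d2 := sqr_ge0 (dlt l).
  have s1 := sqr_ge0 (g l - dlt l); have s2 := sqr_ge0 (g l + dlt l).
  rewrite ler_norml; apply/andP; split; nra.
have : \sum_(j < N | (j %/ n == i %/ n)%N) g i ^+ 2 <=
       \sum_(j < N | (j %/ n == i %/ n)%N) (g j ^+ 2 + Y) by apply: ler_sum.
rewrite big_split /= !sum_block_const /Y -mulr_sumr mulVKf // !big_split /= -!mulr_sumr -/dlt => hh.
rewrite mulrCA ler_pdivlMl //; set U := \sum_(j < N | _) g j ^+ 2 in hh *.
rewrite -/(dlt _); set V := \sum_(j < N | _) _ in hh *.
by apply: le_trans hh _; rewrite /dlt; lra.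
Qed.

End Line.

(** * Block averages: Poincare and Sobolev inequalities *)

Section BlockAverage.
Variables (R : realType) (d N n : nat).
Hypotheses (n_gt0 : (0 < n)%N) (n_dvd : (n %| N)%N).
Local Notation T := (Pt d N).
Implicit Types (x y : T) (mu nu : 'I_d) (f g : T -> R) (s : seq 'I_d).

Definition avgs s f := foldr (avg n) f s.

Definition same_block x y := [forall mu, (y mu %/ n == x mu %/ n)%N].

(** The composite [Q^* Q], kept on the fine lattice so that block labels never appear. *)
Definition bavg f x := n%:R ^- d * \sum_(y | same_block x y) f y.

Let np : 0 < n%:R :> R. Proof. by rewrite ltr0n. Qed.
Let nz : n%:R != 0 :> R. Proof. by rewrite gt_eqF. Qed.

(** Coordinates outside [s] are frozen; this interpolates between [f] and its block average and lets
    the induction run. *)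
Lemma avgs_sum s f x : uniq s ->
  avgs s f x = n%:R ^- size s *
    \sum_(y : T | [forall mu, if mu \in s then (y mu %/ n == x mu %/ n)%N else y mu == x mu]) f y.
Proof.
elim: s x => [|nu s IH] x /=.
  move=> _; rewrite expr0 invr1 mul1r (big_pred1 x) // => y /=.
  by apply/forallP/eqP => [h|-> //]; apply/ffunP => mu; apply/eqP/h.
case/andP=> nus us; rewrite /avg.
under eq_bigr => j _ do rewrite IH //.
rewrite -mulr_sumr mulrA -invfM -exprS; congr (_ * _).
rewrite [RHS](partition_big (fun y : T => y nu) (fun j : 'I_N => (j %/ n == x nu %/ n)%N)) /=; last first.
  by move=> y /forallP /(_ nu); rewrite inE eqxx.
apply: eq_bigr => j bj; apply: eq_bigl => y.
apply/forallP/andP => [h|[/forallP h /eqP yj] mu].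
  have := h nu; rewrite (negbTE nus) upd_same => /eqP yj; split; last by rewrite yj.
  apply/forallP => mu; rewrite inE; case: eqVneq => [->|ne] /=; first by rewrite yj.
  by have := h mu; rewrite !upd_other.
have := h mu; rewrite inE; case: eqVneq => [->|ne] /=.
  by rewrite (negbTE nus) upd_same yj.
by rewrite upd_other.
Qed.

Lemma bavg_avgs f x : bavg f x = avgs (enum 'I_d) f x.
Proof.
rewrite avgs_sum ?enum_uniq // size_enum_ord; congr (_ * _).
by apply: eq_bigl => y; apply: eq_forallb => mu; rewrite mem_enum.
Qed.

Lemma avg1 mu x : avg n mu (fun=> 1 : R) x = 1.
Proof. by rewrite /avg sum_block1 // mulVf. Qed.

Lemma avgs1 s : avgs s (fun=> 1 : R) = fun=> 1.
Proof. by elim: s => //= mu s ->; apply/funext => x; rewrite avg1. Qed.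

Lemma card_block x : \sum_(y | same_block x y) (1 : R) = n%:R ^+ d.
Proof.
have := bavg_avgs (fun=> 1) x; rewrite avgs1 /bavg => h.
have nd : n%:R ^+ d != 0 :> R by rewrite expf_neq0.
by apply: (mulfI (invr_neq0 nd)); rewrite h mulVf.
Qed.

Lemma same_block_sym x y : same_block x y = same_block y x.
Proof. by apply: eq_forallb => mu; rewrite eq_sym. Qed.

Lemma sum_bavg f : \sum_x bavg f x = \sum_x f x.
Proof.
rewrite -mulr_sumr (exchange_big_dep predT) //= mulr_sumr; apply: eq_bigr => y _.
under eq_bigl do rewrite same_block_sym.
rewrite -[X in _ * X](_ : f y * \sum_(i | same_block y i) 1 = _); last first.
  by rewrite mulr_sumr; apply: eq_bigr => i _; rewrite mulr1.
by rewrite card_block mulrCA mulVf ?mulr1 // expf_neq0.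
Qed.

Lemma bavg_sqr_le f x : bavg f x ^+ 2 <= bavg (fun y => f y ^+ 2) x.
Proof.
have cp : 0 < n%:R ^+ d :> R by rewrite exprn_gt0.
rewrite /bavg exprMn; have := sqr_sum_le (same_block x) f; rewrite card_block => h.
rewrite expr2 -mulrA ler_pM2l ?invr_gt0 // ler_pdivrMl //.
Qed.

Lemma avg_sqr_le mu f x : avg n mu f x ^+ 2 <= avg n mu (fun y => f y ^+ 2) x.
Proof.
rewrite /avg exprMn.
have := sqr_sum_le (fun j : 'I_N => (j %/ n == x mu %/ n)%N) (fun j => f (upd x mu j)).
rewrite sum_block1 // => h.
by rewrite expr2 -mulrA ler_pM2l ?invr_gt0 // ler_pdivrMl.
Qed.

Lemma avgsD s f g : avgs s (f \+ g) = avgs s f \+ avgs s g.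
Proof. by elim: s => //= mu s ->; rewrite avgD. Qed.

Lemma avgs_sqr_le s f x : avgs s f x ^+ 2 <= avgs s (fun y => f y ^+ 2) x.
Proof.
elim: s x => //= mu s IH x.
by apply: le_trans (avg_sqr_le _ _ _) _; exact: le_avg.
Qed.

Lemma grad_upd mu f x j :
  grad n mu f (upd x mu j) = n%:R * (f (upd x mu (osucc j)) - f (upd x mu j)).
Proof. by rewrite /grad /sp upd_same upd_upd. Qed.

Lemma avg_poincare mu f x :
  avg n mu (fun y => f y ^+ 2) x <=
  avg n mu f x ^+ 2 + avg n mu (fun y => grad n mu f y ^+ 2) x.
Proof.
apply: le_trans (line_poincare n_gt0 n_dvd (fun j => f (upd x mu j)) (x mu)) _.
rewrite lerD2l ler_pM2l ?invr_gt0 //; apply: ler_sum => j _ /=.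
by rewrite grad_upd.
Qed.

Lemma avg_sobolev mu f x :
  f x ^+ 2 <= 2 * avg n mu (fun y => f y ^+ 2 + grad n mu f y ^+ 2) x.
Proof.
rewrite -[X in f X](upd_id x mu).
apply: le_trans (line_sobolev n_gt0 n_dvd (fun j => f (upd x mu j)) (x mu)) _.
rewrite ler_pM2l // ler_pM2l ?invr_gt0 //; apply: ler_sum => j _ /=.
by rewrite grad_upd.
Qed.

Lemma grad_avgs s mu f : mu \notin s -> grad n mu (avgs s f) = avgs s (grad n mu f).
Proof.
elim: s => //= nu s IH; rewrite inE negb_or => /andP[h1 h2].
by rewrite grad_avg // IH.
Qed.

(** Tensorization: the line inequality in direction [nu] is applied to [avgs s f]. As [nu] is not in
    [s], the gradient passes through those averages, and Jensen then moves the square inside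
    them. *)
Lemma avgs_poincare s f x : uniq s ->
  avgs s (fun y => f y ^+ 2) x <=
  avgs s f x ^+ 2 + \sum_(mu <- s) avgs s (fun y => grad n mu f y ^+ 2) x.
Proof.
elim: s x => [|nu s IH] x /=; first by rewrite big_nil addr0.
case/andP=> nus us; rewrite big_cons.
apply: le_trans (@le_avg _ _ _ _ nu _ _ x (fun y => IH y us)) _.
rewrite (_ : (fun y => _) = (fun y => avgs s f y ^+ 2) \+
     (fun y => \sum_(mu <- s) avgs s (fun y => grad n mu f y ^+ 2) y)) // avgD /= addrA.
apply: lerD.
  apply: le_trans (avg_poincare _ _ _) _; rewrite lerD2l grad_avgs //.
  by apply: le_avg => y; exact: avgs_sqr_le.
(* What remains is to pull the sum over [s] out of [avg n nu]; abstracting [avgs s] as [A] separates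
   it from the list under induction. *)
elim: s {IH us nus} x (avgs s) => [|mu s IH] x A.
  by rewrite big_nil /avg big1 ?mulr0 // => i _; rewrite big_nil.
rewrite big_cons -lerBlDl; apply: le_trans (IH _ _); rewrite lerBlDl.
rewrite -[leRHS]/((avg n nu _ \+ avg n nu _) x) -avgD.
by apply: le_avg => y; rewrite big_cons.
Qed.

Lemma poincare f :
  \sum_x f x ^+ 2 <= \sum_x bavg f x ^+ 2 + \sum_mu \sum_x grad n mu f x ^+ 2.
Proof.
rewrite -sum_bavg.
rewrite [X in _ + X](eq_bigr (fun mu => \sum_x bavg (fun y => grad n mu f y ^+ 2) x)); last first.
  by move=> mu _; rewrite sum_bavg.
rewrite exchange_big -big_split /=; apply: ler_sum => x _; rewrite !bavg_avgs.
apply: le_trans (avgs_poincare _ _ (enum_uniq _)) _; rewrite lerD2l big_enum /=.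
by apply: ler_sum => mu _; rewrite bavg_avgs.
Qed.

(** Unfolds to the sum of squared mixed differences over all sublists of [s]: the anisotropic
    Sobolev energy, with at most one derivative in each direction. *)
Fixpoint sob s f : T -> R :=
  if s is nu :: s' then sob s' f \+ sob s' (grad n nu f) else fun x => f x ^+ 2.

Lemma sob_ge0 s f x : 0 <= sob s f x.
Proof. by elim: s f => [|nu s IH] f /=; rewrite ?sqr_ge0 ?addr_ge0. Qed.

Lemma avgs_sobolev s f x : f x ^+ 2 <= 2 ^+ size s * avgs s (sob s f) x.
Proof.
elim: s f x => [|nu s IH] f x /=; first by rewrite expr0 mul1r.
apply: le_trans (avg_sobolev nu f x) _; rewrite exprS -mulrA ler_pM2l //.
rewrite -[leRHS]/((fun x => _ * avg n nu _ x) x) -avgZ; apply: le_avg => y.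
by rewrite avgsD /= mulrDr; apply: lerD.
Qed.

Lemma sobolev f x :
  f x ^+ 2 <= 2 ^+ d * n%:R ^- d * \sum_y sob (enum 'I_d) f y.
Proof.
apply: le_trans (avgs_sobolev (enum 'I_d) f x) _.
rewrite -bavg_avgs size_enum_ord -mulrA ler_pM2l ?exprn_gt0 //.
rewrite ler_pM2l ?invr_gt0 ?exprn_gt0 //.
by apply: ler_sum_sub => // y; exact: sob_ge0.
Qed.

End BlockAverage.

(** * Powers of the massive Laplacian *)

Section Resolvent.
Variables (R : realType) (d N n : nat).
Local Notation T := (Pt d N).
Implicit Types (x y : T) (mu nu : 'I_d) (f g : T -> R) (s w : seq 'I_d) (c : R).

Definition lapw w f := foldr (lap n) f w.

Definition Bop c f x := c * f x + \sum_mu lap n mu f x.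

Fixpoint Pop s f : T -> R :=
  if s is nu :: s' then Pop s' f \+ lap n nu (Pop s' f) else f.

Lemma lap_lapw mu w f : lap n mu (lapw w f) = lapw w (lap n mu f).
Proof. by elim: w => //= nu w IH; rewrite lap_lap IH. Qed.

Lemma lapwD w f g : lapw w (f \+ g) = lapw w f \+ lapw w g.
Proof. by elim: w => //= nu w ->; rewrite lapD. Qed.

Lemma lapw_rem mu w f : mu \in w -> lapw w f = lap n mu (lapw (rem mu w) f).
Proof.
elim: w => //= nu w IH; rewrite inE; case: (eqVneq nu mu) => [<-//|ne] /=.
by move=> /IH ->; rewrite lap_lap.
Qed.

Lemma grad_lapw mu w f : mu \notin w -> grad n mu (lapw w f) = lapw w (grad n mu f).
Proof.
elim: w => //= nu w IH; rewrite inE negb_or => /andP[ne /IH <-].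
by rewrite grad_lap.
Qed.

(** With Neumann faces [grad mu] commutes with [lap nu] only for distinct directions, hence the case
    split. If [mu] recurs in [w], one factor [lap mu] goes to each side and two letters disappear;
    otherwise one integrates by parts. *)
Lemma lapw_psd w f : 0 <= \sum_x f x * lapw w f x.
Proof.
have [k] := ubnP (size w); elim: k w f => // k IH [|mu w] f /= sw.
  by apply: sumr_ge0 => x _; rewrite -expr2 sqr_ge0.
case: (boolP (mu \in w)) => [mw|mw]; last by rewrite lap_ibp grad_lapw //; exact: IH.
rewrite lap_sym (lapw_rem _ mw) lap_lapw; apply: IH.
rewrite size_rem //; move: sw; rewrite ltnS => sw. exact: (leq_ltn_trans (leq_pred _) sw).
Qed.

Lemma lapwZ w c f : lapw w (fun x => c * f x) = (fun x => c * lapw w f x).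
Proof. by elim: w => //= nu w ->; rewrite lapZ. Qed.

Lemma lapw_sum w (F : 'I_d -> T -> R) s :
  lapw w (fun x => \sum_(mu <- s) F mu x) = (fun x => \sum_(mu <- s) lapw w (F mu) x).
Proof.
elim: s => [|nu s IH].
  have -> : (fun x : T => \sum_(mu <- [::]) F mu x) = fun x => 0 * (fun=> 0) x.
    by apply/funext => x; rewrite big_nil mul0r.
  by rewrite lapwZ; apply/funext => x; rewrite mul0r big_nil.
have -> : (fun x : T => \sum_(mu <- nu :: s) F mu x) = F nu \+ (fun x => \sum_(mu <- s) F mu x).
  by apply/funext => x; rewrite big_cons.
by rewrite lapwD IH; apply/funext => x; rewrite big_cons.
Qed.

Lemma lapw_Bop w c f x :
  lapw w (Bop c f) x = c * lapw w f x + \sum_mu lapw (mu :: w) f x.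
Proof.
rewrite (_ : Bop c f = (fun x => c * f x) \+ (fun x => \sum_mu lap n mu f x)) //.
rewrite lapwD /= lapwZ lapw_sum; congr (_ + _).
by apply: eq_bigr => mu _; rewrite lap_lapw.
Qed.

Lemma sum_lapw_Bop w c f g :
  \sum_x f x * lapw w (Bop c g) x =
  c * (\sum_x f x * lapw w g x) + \sum_mu \sum_x f x * lapw (mu :: w) g x.
Proof.
rewrite mulr_sumr exchange_big -big_split /=; apply: eq_bigr => x _.
rewrite lapw_Bop mulrDr mulr_sumr; congr (_ + _).
by rewrite mulrCA.
Qed.

Lemma lapw_Bop_psd w c m f : 0 <= c -> 0 <= \sum_x f x * lapw w (iter m (Bop c) f) x.
Proof.
move=> c0; elim: m w => [|m IH] w; first exact: lapw_psd.
rewrite iterS sum_lapw_Bop addr_ge0 ?mulr_ge0 //.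
by apply: sumr_ge0 => mu _; exact: IH.
Qed.

(* After expansion into monomials in the commuting operators [lap mu], every
   monomial of [prod_(mu in s) (1 + lap mu)] occurs in [Bop c ^ size s]. *)
Lemma Pop_le_Bop c s w f : 1 <= c ->
  \sum_x f x * lapw w (Pop s f) x <= \sum_x f x * lapw w (iter (size s) (Bop c) f) x.
Proof.
move=> c1; elim: s w => [//|nu s IH] w /=.
have c0 : 0 <= c by lra.
rewrite sum_lapw_Bop lapwD -lap_lapw -[lap _ _ (lapw _ _)]/(lapw (nu :: w) _).
have -> : \sum_x f x * (lapw w (Pop s f) \+ lapw (nu :: w) (Pop s f)) x =
   \sum_x f x * lapw w (Pop s f) x + \sum_x f x * lapw (nu :: w) (Pop s f) x.
  by rewrite -big_split; apply: eq_bigr => x _; rewrite mulrDr.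
apply: lerD; first by apply: le_trans (IH _) _; rewrite ler_peMl // lapw_Bop_psd.
apply: le_trans (IH _) _; rewrite (bigD1 nu) //= lerDl.
by apply: sumr_ge0 => mu _; exact: (@lapw_Bop_psd (mu :: w)).
Qed.

Lemma grad_Pop nu s f : nu \notin s -> grad n nu (Pop s f) = Pop s (grad n nu f).
Proof.
elim: s => //= mu s IH; rewrite inE negb_or => /andP[ne /IH <-].
by rewrite -grad_lap //; apply/funext => x; rewrite /grad /=; ring.
Qed.

(** Each square of a gradient is integrated by parts back into a factor [lap nu]; [uniq s] lets that
    gradient commute with the remaining factors. *)
Lemma sum_sob s f : uniq s -> \sum_x sob n s f x = \sum_x f x * Pop s f x.
Proof.
elim: s f => [|nu s IH] f /=; first by move=> _; apply: eq_bigr => x _; rewrite expr2.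
case/andP=> nus us; rewrite big_split /= !IH // -grad_Pop // -lap_ibp -big_split /=.
by apply: eq_bigr => x _; rewrite mulrDr.
Qed.

Lemma sobolev_Bop c f x : (0 < n)%N -> (n %| N)%N -> 1 <= c ->
  f x ^+ 2 <= 2 ^+ d * n%:R ^- d * \sum_y f y * iter d (Bop c) f y.
Proof.
move=> n0 nN c1; apply: le_trans (sobolev n0 nN f x) _.
rewrite ler_wpM2l ?mulr_ge0 ?invr_ge0 ?exprn_ge0 ?ler0n //.
rewrite sum_sob ?enum_uniq //.
by have := Pop_le_Bop (enum 'I_d) [::] f c1; rewrite size_enum_ord.
Qed.

Lemma Bop_sym c f g : \sum_x f x * Bop c g x = \sum_x Bop c f x * g x.
Proof.
have := sum_lapw_Bop [::] c f g; rewrite /= => ->.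
under [RHS]eq_bigr do rewrite mulrC.
have := sum_lapw_Bop [::] c g f; rewrite /= => ->; congr (_ * _ + _).
  by apply: eq_bigr => x _; rewrite mulrC.
by apply: eq_bigr => mu _; rewrite lap_sym; apply: eq_bigr => x _; rewrite mulrC.
Qed.

(** At a minimum point every [lap mu f] is nonpositive, clamped neighbours included, so [c * f]
    dominates [Bop c f] there. *)
Lemma max_principle c f : 0 < c -> (forall x, 0 <= Bop c f x) -> forall x, 0 <= f x.
Proof.
move=> c0 Bf x0; pose x := [arg min_(y < x0) f y]%O.
have xmin y : f x <= f y by rewrite /x; case: arg_minP => // i _; exact.
apply: le_trans (xmin x0); rewrite -(pmulr_rge0 _ c0).
apply: le_trans (Bf x) _; rewrite /Bop gerDl; apply: sumr_le0 => mu _.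
rewrite /lap mulr_ge0_le0 ?exprn_ge0 ?ler0n //.
by have := xmin (sp mu x); have := xmin (sm mu x); lra.
Qed.

End Resolvent.

(** * Resolvent kernels *)

Section OperatorMatrix.
Variables (R : realType) (T : finType).
Implicit Types (f : T -> R) (M : (T -> R) -> T -> R).

Definition delta (y x : T) : R := (x == y)%:R.

Definition opmat M : 'M[R]_#|{: T}| := \matrix_(i, j) M (delta (enum_val j)) (enum_val i).

(** Shaped like [Gk], so that the complex inverse reduces to this one entry by entry. *)
Definition invop M f x : R :=
  \sum_(j < #|{: T}|) invmx (opmat M) (enum_rank x) j * f (enum_val j).

Definition finlinear M := forall f x, M f x = \sum_y f y * M (delta y) x.

Lemma sum_delta (y : T) f : \sum_x f x * delta y x = f y.
Proof.
rewrite (bigD1 y) //= /delta eqxx mulr1 big1 ?addr0 // => x /negbTE ->.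
by rewrite mulr0.
Qed.

Lemma opmatE M f i : finlinear M ->
  \sum_j opmat M i j * f (enum_val j) = M f (enum_val i).
Proof.
move=> lM; rewrite lM [RHS](reindex (@enum_val T predT)) /=; last first.
  by exists enum_rank => y _; rewrite ?enum_valK ?enum_rankK.
by apply: eq_bigr => j _; rewrite mxE mulrC.
Qed.

Lemma opmat_unit M : finlinear M -> (forall f, (forall x, M f x = 0) -> forall x, f x = 0) ->
  opmat M \in unitmx.
Proof.
(* [kermx] is a left kernel; after transposition its rows are solutions of [M f = 0]. *)
move=> lM injM; rewrite -unitmx_tr -row_free_unit -kermx_eq0.
apply/eqP/row_matrixP => i; rewrite row0; set r := row i _.
have rM : r *m (opmat M)^T = 0 by rewrite /r -row_mul mulmx_ker row0.
pose f y := r 0 (enum_rank y).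
have f0 : forall x, f x = 0.
  apply: injM => x; rewrite -(enum_rankK x) -opmatE //.
  move/matrixP: rM => /(_ 0 (enum_rank x)); rewrite !mxE.
  by move=> h; apply: etrans h; apply: eq_bigr => j _; rewrite [X in _ = _ * X]mxE /f enum_valK mulrC.
apply/rowP => v; rewrite [RHS]mxE.
by rewrite -(f0 (enum_val v)) /f enum_valK.
Qed.

Lemma invopK M f : finlinear M -> (forall f, (forall x, M f x = 0) -> forall x, f x = 0) ->
  M (invop M f) = f.
Proof.
move=> lM injM; have U := opmat_unit lM injM; apply/funext => x.
rewrite -[in LHS](enum_rankK x) -opmatE //.
pose F : 'cV[R]_#|{: T}| := \col_j f (enum_val j).
have /matrixP /(_ (enum_rank x) 0) := mulKVmx U F.
rewrite [RHS]mxE enum_rankK => <-; rewrite [RHS]mxE; apply: eq_bigr => j _.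
congr (_ * _); rewrite mxE /invop enum_valK; apply: eq_bigr => l _.
by rewrite [F _ _]mxE.
Qed.

End OperatorMatrix.

Section Kernels.
Variables (R : realType) (d N n : nat) (c : R).
Hypotheses (n_gt0 : (0 < n)%N) (n_dvd : (n %| N)%N) (c_ge1 : 1 <= c).
Local Notation T := (Pt d N).
Implicit Types (x y : T) (mu nu : 'I_d) (f g : T -> R).
Local Notation B := (Bop n c).

Let c_gt0 : 0 < c. Proof. exact: lt_le_trans c_ge1. Qed.

Lemma finlinear_lap mu : finlinear (@lap R d N n mu).
Proof.
move=> f x; rewrite /lap.
rewrite (eq_bigr (fun y => n%:R ^+ 2 * (2 * (f y * delta R x y) - f y * delta R (sp mu x) y
           - f y * delta R (sm mu x) y))); last first.
  by move=> y _; rewrite /delta (eq_sym y x) (eq_sym y (sp mu x)) (eq_sym y (sm mu x)); ring.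
rewrite -mulr_sumr !sumrB; congr (_ * (_ - _ - _)); last 2 first.
- by rewrite sum_delta.
- by rewrite sum_delta.
- by rewrite -mulr_sumr sum_delta.
Qed.

Lemma finlinear_Bop : finlinear (@Bop R d N n c).
Proof.
move=> f x; rewrite /Bop.
rewrite (eq_bigr (fun y => c * (f y * delta R x y) + \sum_mu f y * lap n mu (delta R y) x)); last first.
  by move=> y _; rewrite mulrDr mulr_sumr /delta (eq_sym y x); congr (_ + _); ring.
rewrite big_split /=; congr (_ + _); first by rewrite -mulr_sumr sum_delta.
rewrite exchange_big /=.
by apply: eq_bigr => mu _; rewrite finlinear_lap.
Qed.

Lemma BopN f x : B (fun y => - f y) x = - B f x.
Proof.
rewrite /Bop opprD mulrN -sumrN; congr (_ + _).
by apply: eq_bigr => mu _; rewrite /lap; ring.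
Qed.

Lemma BopB f g x : B (fun y => f y - g y) x = B f x - B g x.
Proof.
rewrite /Bop mulrBr opprD addrACA -sumrB; congr (_ + _).
by apply: eq_bigr => mu _; rewrite /lap; ring.
Qed.

Lemma Bop_inj f : (forall x, B f x = 0) -> forall x, f x = 0.
Proof.
move=> Bf x; apply/eqP; rewrite eq_le; apply/andP; split; last first.
  by apply: (max_principle (n := n) c_gt0) => y; rewrite Bf.
rewrite -oppr_ge0; apply: (max_principle (n := n) c_gt0 (f := fun y => - f y)) => y.
by rewrite BopN Bf oppr0.
Qed.

Definition res f := invop B f.

Lemma Bop_res f : B (res f) = f.
Proof. exact: invopK finlinear_Bop Bop_inj. Qed.

Lemma res_le f g : (forall x, f x <= B g x) -> forall x, res f x <= g x.
Proof.
move=> h x; rewrite -subr_ge0.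
apply: (max_principle (n := n) c_gt0 (f := fun y => g y - res f y)) => y.
by rewrite BopB Bop_res subr_ge0.
Qed.

Lemma res_ge0 f : (forall x, 0 <= f x) -> forall x, 0 <= res f x.
Proof. by move=> h; apply: (max_principle (n := n) c_gt0) => y; rewrite Bop_res. Qed.

Lemma res_Bop f : res (B f) = f.
Proof.
apply/funext => x; apply/eqP; rewrite -subr_eq0; apply/eqP.
by apply: (Bop_inj (f := fun x => res (B f) x - f x)) => y; rewrite BopB Bop_res subrr.
Qed.

Lemma res_sym f g : \sum_x f x * res g x = \sum_x res f x * g x.
Proof. by rewrite -[in LHS](Bop_res f) -Bop_sym Bop_res. Qed.

(* The source is the plain delta, without the factor [eta^-d] of the continuum
   normalization: [ker i x0] is [eta^d] times the kernel of [B^-i]. *)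
Definition ker i x0 := iter i res (delta R x0).

Lemma ker_ge0 i x0 x : 0 <= ker i x0 x.
Proof. by elim: i x => [|i IH] x /=; [exact: ler0n | exact: res_ge0]. Qed.

(** The hypothesis makes [2 * W] a supersolution with source [W], so a resolvent at most doubles
    [W]. Symmetry moves the resolvents from the kernel onto [W], one at a time. *)
Lemma sum_ker_le i x0 W : (forall x, W x / 2 <= B W x) ->
  \sum_x ker i x0 x * W x <= 2 ^+ i * W x0.
Proof.
move=> hW; elim: i => [|i IH].
  by rewrite expr0 mul1r -(sum_delta x0 W) le_eqVlt (eq_bigr _ (fun x _ => mulrC _ _)) eqxx.
rewrite /ker iterS -res_sym exprS -mulrA.
apply: le_trans (ler_wpM2l _ IH) => //; rewrite mulr_sumr; apply: ler_sum => x _.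
rewrite mulrCA ler_wpM2l ?ker_ge0 //.
apply: (res_le (g := fun x => 2 * W x)) => y; have := hW y.
have -> : B (fun x => 2 * W x) y = 2 * B W y.
  rewrite /Bop mulrDr mulr_sumr mulrCA; congr (_ + _).
  by apply: eq_bigr => mu _; rewrite /lap; ring.
by lra.
Qed.

Lemma iter_Bop_ker i x0 : iter i B (ker i x0) = delta R x0.
Proof. by elim: i => // i IH; rewrite iterSr /ker iterS Bop_res. Qed.

(* The Sobolev bound at [x0] itself is self-improving: [v(x0)^2 <= C v(x0)]. *)
Lemma ker_sup x0 x : ker d x0 x <= 2 ^+ d * n%:R ^- d.
Proof.
have S y := sobolev_Bop (ker d x0) y n_gt0 n_dvd c_ge1.
have E y : ker d x0 y ^+ 2 <= 2 ^+ d * n%:R ^- d * ker d x0 x0.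
  by have := S y; rewrite iter_Bop_ker sum_delta.
have C0 : 0 <= 2 ^+ d * n%:R ^- d :> R.
  by rewrite mulr_ge0 ?invr_ge0 ?exprn_ge0 ?ler0n.
have k0 := ker_ge0 d x0 x0; have kx := ker_ge0 d x0 x.
have h0 : ker d x0 x0 <= 2 ^+ d * n%:R ^- d.
  case: (eqVneq (ker d x0 x0) 0) => [->//|ne].
  by rewrite -(ler_pM2r (x := ker d x0 x0)) ?lt_def ?ne // -expr2.
rewrite -(ler_pXn2r (n := 2)) ?nnegrE //; apply: le_trans (E x) _.
by rewrite [leRHS]expr2 ler_wpM2l.
Qed.

End Kernels.

(** * Weighted energy estimate *)

Section WeightedEnergy.
Variables (R : realType) (d N n : nat).
Hypotheses (n_gt0 : (0 < n)%N) (n_dvd : (n %| N)%N).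
Local Notation T := (Pt d N).
Implicit Types (x y : T) (mu nu : 'I_d) (f g u v W : T -> R).

Lemma bavg_same_block f x y : same_block n x y -> bavg n f y = bavg n f x.
Proof.
move=> /forallP xy; congr (_ * _); apply: eq_bigl => z.
by apply: eq_forallb => mu; rewrite (eqP (xy mu)).
Qed.

(** Expresses that [bavg] is an orthogonal projection. *)
Lemma sum_mul_bavg f : \sum_x f x * bavg n f x = \sum_x bavg n f x ^+ 2.
Proof.
rewrite -(sum_bavg n_gt0 n_dvd); apply: eq_bigr => x _.
rewrite expr2 {3}/bavg -mulrA [in RHS]mulr_suml; congr (_ * _).
by apply: eq_bigr => y xy; rewrite (bavg_same_block _ xy).
Qed.

Lemma sum_mul_bavg_norm f : \sum_x `|f x| * bavg n (fun y => `|f y|) x <= \sum_x f x ^+ 2.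
Proof.
have h x : `|f x| * bavg n (fun y => `|f y|) x <=
    2^-1 * (f x ^+ 2) + 2^-1 * bavg n (fun y => f y ^+ 2) x.
  have := bavg_sqr_le n_gt0 n_dvd (fun y => `|f y|) x.
  rewrite (_ : (fun y => `|f y| ^+ 2) = fun y => f y ^+ 2); last first.
    by apply/funext => y; rewrite real_normK ?num_real.
  have := sqr_ge0 (`|f x| - bavg n (fun y => `|f y|) x).
  have : `|f x| ^+ 2 = f x ^+ 2 by rewrite real_normK ?num_real.
  by nra.
apply: le_trans (ler_sum _ (fun x _ => h x)) _.
rewrite big_split /= [X in _ + X](_ : _ = 2^-1 * \sum_x f x ^+ 2); last first.
  by rewrite -[in RHS](sum_bavg n_gt0 n_dvd) mulr_sumr.
rewrite [X in X + _](_ : _ = 2^-1 * \sum_x f x ^+ 2); last by rewrite mulr_sumr.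
by set X := \sum_x _; lra.
Qed.

(** Points fixed by [sp mu] are left out: otherwise the top layer would be counted twice. *)
Lemma sum_sp_le mu v : \sum_x (if sp mu x == x then 0 else v (sp mu x) ^+ 2) <= \sum_x v x ^+ 2.
Proof.
pose phi x y := if x == y then 0 else v x ^+ 2.
have <- : \sum_x phi x (sm mu x) = \sum_x phi (sp mu x) x.
  by apply: sum_bonds => x; rewrite /phi eqxx.
by apply: ler_sum => x _; rewrite /phi; case: ifP => // _; exact: sqr_ge0.
Qed.

Section Weight.
Variables (W : T -> R) (kappa dlt : R).
Hypotheses (W_gt0 : forall x, 0 < W x) (dlt_ge0 : 0 <= dlt).
Hypothesis W_bond : forall mu x,
  n%:R ^+ 2 * (W (sp mu x) - W x) ^+ 2 <= 4 * kappa ^+ 2 * (W (sp mu x) * W x).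
Hypothesis W_block : forall x y, same_block n x y -> `|W y - W x| <= dlt * W x.

(** With [v = u / W], each bond gives exactly [(grad v)^2 - q v v'], where [q] is the left side of
    [W_bond] divided by the product of the two weights. This identity dictates the geometric-mean
    form of [W_bond]. *)
Lemma weighted_lap mu u :
  \sum_x grad n mu (fun y => u y / W y) x ^+ 2 - 4 * kappa ^+ 2 * (\sum_x (u x / W x) ^+ 2)
  <= \sum_x u x / W x ^+ 2 * lap n mu u x.
Proof.
rewrite (lap_ibp n mu (fun x => u x / W x ^+ 2)).
pose v x := u x / W x.
pose v2 x := if sp mu x == x then 0 else v (sp mu x) ^+ 2.
have h x : grad n mu v x ^+ 2 - 2 * kappa ^+ 2 * (v x ^+ 2 + v2 x) <=
     grad n mu (fun x => u x / W x ^+ 2) x * grad n mu u x.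
  rewrite /grad /v2; case: eqP => [->|_].
    rewrite !subrr !mulr0 expr0n /=.
    by have := mulr_ge0 (sqr_ge0 kappa) (sqr_ge0 (v x)); lra.
  have p := W_gt0 x; have p' := W_gt0 (sp mu x).
  have -> : u x / W x ^+ 2 = v x / W x by rewrite /v; field; rewrite gt_eqF.
  have -> : u (sp mu x) / W (sp mu x) ^+ 2 = v (sp mu x) / W (sp mu x).
    by rewrite /v; field; rewrite gt_eqF.
  have -> : u x = W x * v x by rewrite /v; field; rewrite gt_eqF.
  have -> : u (sp mu x) = W (sp mu x) * v (sp mu x) by rewrite /v; field; rewrite gt_eqF.
  have := W_bond mu x; rewrite -ler_pdivrMr ?mulr_gt0 //.
  set w := W x in p *; set w' := W (sp mu x) in p' *.
  set a := v x; set a' := v (sp mu x); set q := _ / _ => qk.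
  have -> : n%:R * (a' / w' - a / w) * (n%:R * (w' * a' - w * a)) =
     (n%:R * (a' - a)) ^+ 2 - q * (a * a').
    by rewrite /q; field; rewrite !gt_eqF.
  have q0 : 0 <= q.
    by rewrite /q divr_ge0 // mulr_ge0 ?sqr_ge0 // ltW.
  have s1 := sqr_ge0 (a - a'); have s2 := sqr_ge0 (a + a').
  have : q * (a * a') <= 4 * kappa ^+ 2 * (2^-1 * (a ^+ 2 + a' ^+ 2)).
    apply: le_trans (_ : q * (2^-1 * (a ^+ 2 + a' ^+ 2)) <= _).
      by rewrite ler_wpM2l //; nra.
    by rewrite ler_wpM2r //; nra.
  by lra.
apply: le_trans (ler_sum _ (fun x _ => h x)).
rewrite sumrB lerD2l lerN2 -mulr_sumr big_split /=.
have := sum_sp_le mu v; rewrite -/v2 => h2; rewrite -/v.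
have := mulr_ge0 (sqr_ge0 kappa) (_ : 0 <= \sum_x v x ^+ 2 - \sum_x v2 x).
by rewrite subr_ge0 => /(_ h2); lra.
Qed.

(** Conjugation by [W] multiplies the kernel of [bavg] by [W y / W x], within [dlt] of 1 on a block;
    the error is thus at most [dlt] times a contraction. *)
Lemma weighted_bavg u :
  \sum_x bavg n (fun y => u y / W y) x ^+ 2 - dlt * (\sum_x (u x / W x) ^+ 2)
  <= \sum_x u x / W x ^+ 2 * bavg n u x.
Proof.
pose v x := u x / W x.
have h x : v x * bavg n v x - dlt * (`|v x| * bavg n (fun y => `|v y|) x) <=
    u x / W x ^+ 2 * bavg n u x.
  have p := W_gt0 x.
  have -> : u x / W x ^+ 2 = v x / W x by rewrite /v; field; rewrite gt_eqF.
  rewrite /bavg !(mulrCA _ (n%:R ^- d)) -mulrBr ler_wpM2l ?invr_ge0 ?exprn_ge0 ?ler0n //.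
  rewrite !mulr_sumr -sumrB; apply: ler_sum => y xy.
  have p' := W_gt0 y; have b := W_block xy.
  have -> : u y = W y * v y by rewrite /v; field; rewrite gt_eqF.
  rewrite -subr_ge0.
  have -> : v x / W x * (W y * v y) - (v x * v y - dlt * (`|v x| * `|v y|)) =
    ((W y - W x) * (v x * v y) + dlt * W x * `|v x * v y|) / W x.
    by rewrite (normrM (v x)); field; rewrite gt_eqF.
  rewrite divr_ge0 //; last exact: ltW.
  have := ler_norm (- ((W y - W x) * (v x * v y))); rewrite normrN normrM.
  by have := ler_wpM2r (normr_ge0 (v x * v y)) b; lra.
apply: le_trans (ler_sum _ (fun x _ => h x)).
rewrite sumrB sum_mul_bavg lerD2l lerN2 -mulr_sumr ler_wpM2l //.
exact: sum_mul_bavg_norm.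
Qed.

Definition Areal (al m2 : R) u x := \sum_mu lap n mu u x + m2 * u x + al * bavg n u x.

(** Poincare on blocks gives coercivity [a / 2], since both the gradient coefficient 1 and [al] are
    at least [a / 2]. The conjugation errors consume at most [a / 4] of it. *)
Lemma weighted_l2 (a al m2 : R) u :
  0 < a -> a / 2 <= al <= 1 -> 0 <= m2 -> 4 * d%:R * kappa ^+ 2 + dlt <= a / 4 ->
  \sum_x (u x / W x) ^+ 2 <= 16 / a ^+ 2 * \sum_x (Areal al m2 u x / W x) ^+ 2.
Proof.
move=> a0 /andP[al1 al2] m20 small.
pose v x := u x / W x; pose F x := Areal al m2 u x / W x.
rewrite -[X in X <= _]/(\sum_x v x ^+ 2) -[X in _ <= _ * X]/(\sum_x F x ^+ 2).
set V := \sum_x v x ^+ 2; set X := \sum_x F x ^+ 2.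
have V0 : 0 <= V by apply: sumr_ge0 => x _; exact: sqr_ge0.
have E : \sum_x v x * F x = \sum_mu \sum_x u x / W x ^+ 2 * lap n mu u x
    + m2 * V + al * \sum_x u x / W x ^+ 2 * bavg n u x.
  rewrite exchange_big /V !mulr_sumr -!big_split /=; apply: eq_bigr => x _.
  rewrite -mulr_sumr /F /v /Areal; set S := \sum_mu _.
  by field; rewrite gt_eqF.
have L : \sum_mu \sum_x grad n mu v x ^+ 2 - 4 * d%:R * kappa ^+ 2 * V <=
   \sum_mu \sum_x u x / W x ^+ 2 * lap n mu u x.
  apply: le_trans (ler_sum _ (fun mu _ => weighted_lap mu u)).
  rewrite sumrB sumr_const card_ord -[X in _ <= _ - X]mulr_natr -/v -/V lerD2l lerN2.
  by rewrite le_eqVlt; apply/orP; left; apply/eqP; ring.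
have Q := weighted_bavg u; rewrite -/v -/V in Q.
have P := poincare n_gt0 n_dvd v; rewrite -/V in P.
set G := \sum_mu \sum_x grad n mu v x ^+ 2 in L P.
set Y := \sum_x bavg n v x ^+ 2 in Q P.
have G0 : 0 <= G by apply: sumr_ge0 => mu _; apply: sumr_ge0 => x _; exact: sqr_ge0.
have Y0 : 0 <= Y by apply: sumr_ge0 => x _; exact: sqr_ge0.
have lower : a / 4 * V <= \sum_x v x * F x.
  rewrite E; set Z := \sum_x u x / W x ^+ 2 * bavg n u x in Q *.
  have h1 : al * (Y - dlt * V) <= al * Z by rewrite ler_wpM2l //; lra.
  have h2 : a / 2 * V <= G + al * Y.
    apply: le_trans (_ : a / 2 * (Y + G) <= _); first by rewrite ler_wpM2l //; lra.
    have : a / 2 * Y <= al * Y by rewrite ler_wpM2r.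
    have : a / 2 * G <= 1 * G by rewrite ler_wpM2r //; lra.
    by lra.
  have h3 : (4 * d%:R * kappa ^+ 2 + dlt) * V <= a / 4 * V by rewrite ler_wpM2r.
  have h4 : al * (dlt * V) <= dlt * V by rewrite ler_piMl // mulr_ge0.
  have h5 := mulr_ge0 m20 V0.
  by lra.
(* Young's inequality, weighted to leave half of the lower bound [a / 4 * V]. *)
have upper : \sum_x v x * F x <= a / 8 * V + 2 / a * X.
  rewrite !mulr_sumr -big_split /=; apply: ler_sum => x _.
  rewrite -subr_ge0.
  have -> : a / 8 * v x ^+ 2 + 2 / a * F x ^+ 2 - v x * F x =
     (a * v x - 4 * F x) ^+ 2 / (8 * a) by field; rewrite gt_eqF.
  by rewrite divr_ge0 ?sqr_ge0 // mulr_ge0 // ltW.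
have h : a / 8 * V <= 2 / a * X by lra.
have -> : 16 / a ^+ 2 * X = 8 / a * (2 / a * X) by field; rewrite gt_eqF.
have -> : V = 8 / a * (a / 8 * V) by field; rewrite gt_eqF.
by rewrite ler_wpM2l // divr_ge0 // ltW.
Qed.

End Weight.
End WeightedEnergy.

(** * The hyperbolic cosine weight *)

Section CoshWeight.
Variable (R : realType).
Implicit Types (s t kappa : R).

(** A smooth majorant of [exp |s|] which, by [chh_addsub], is an exact eigenfunction of the second
    difference. *)
Definition chh s : R := expR s + expR (- s).

Lemma chh_gt0 s : 0 < chh s. Proof. by rewrite addr_gt0 ?expR_gt0. Qed.

Lemma chh0 : chh 0 = 2. Proof. by rewrite /chh oppr0 expR0. Qed.

Lemma expR_norm_le_chh s : expR `|s| <= chh s.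
Proof.
rewrite /chh; case: (ger0P s) => _; first by rewrite lerDl expR_ge0.
by rewrite lerDr expR_ge0.
Qed.

Lemma chh_addsub s t : chh (s + t) + chh (s - t) = chh t * chh s.
Proof. by rewrite /chh !opprD !opprK !expRD; ring. Qed.

Lemma chhD_le s t : chh (s + t) <= expR `|t| * chh s.
Proof.
have es := expR_gt0 s; have es' := expR_gt0 (- s).
have l1 : expR t <= expR `|t| by rewrite ler_expR ler_norm.
have l2 : expR (- t) <= expR `|t| by rewrite ler_expR -normrN ler_norm.
by rewrite /chh opprD !expRD mulrDr; apply: lerD; rewrite mulrC ler_wpM2r // ltW.
Qed.

Lemma chh_le s t : 0 <= s -> 0 <= t -> chh s <= chh (s + t).
Proof.
move=> s0 t0; rewrite -subr_ge0.
have -> : chh (s + t) - chh s = (expR t - 1) * (expR s - expR (- s) * expR (- t)).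
  rewrite /chh opprD !expRD; have : expR t * expR (- t) = 1 by rewrite -expRD subrr expR0.
  move=> e; have : expR t * expR (- t) * expR (- s) = expR (- s) by rewrite e mul1r.
  by lra.
rewrite mulr_ge0 // subr_ge0; first by rewrite -expR0 ler_expR.
by rewrite -expRD ler_expR; lra.
Qed.

Lemma chhN s : chh (- s) = chh s. Proof. by rewrite /chh opprK addrC. Qed.

Lemma chh_sub2_le t : 0 <= t <= 1 -> chh t - 2 <= 4 * t ^+ 2.
Proof.
(* Half-argument exponentials make [chh t - 2] a perfect square, so a linear bound on [p - q]
   suffices. *)
move=> /andP[t0 t1]; pose p := expR (t / 2); pose q := expR (- (t / 2)).
have pq : p * q = 1 by rewrite /p /q -expRD subrr expR0.
have -> : chh t - 2 = (p - q) ^+ 2.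
  have e1 : expR t = p ^+ 2 by rewrite expr2 /p -expRD; congr expR; field.
  have e2 : expR (- t) = q ^+ 2 by rewrite expr2 /q -expRD; congr expR; field.
  by rewrite /chh e1 e2 sqrrB; lra.
have q1 : 1 - t / 2 <= q by rewrite /q; have := expR_ge1Dx (- (t / 2)); lra.
have p0 : 0 < p := expR_gt0 _.
have pq0 : q <= p by rewrite ler_expR; lra.
have p2 : p <= 2 by nra.
have : p - q <= 2 * t by nra.
move=> h; have h0 : 0 <= p - q by lra.
have -> : 4 * t ^+ 2 = (2 * t) ^+ 2 by ring.
by rewrite ler_pXn2r ?nnegrE ?mulr_ge0.
Qed.

(** The ratio of the two values lies between [exp (- t)] and [exp t], the roots of
    [X^2 - chh t * X + 1]; the sign of this quadratic between its roots is the claim. *)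
Lemma chh_ratio s t : 0 <= t -> (chh (s + t) - chh s) ^+ 2 <= (chh t - 2) * (chh (s + t) * chh s).
Proof.
move=> t0; have h1 := chhD_le s t; have h2 := chhD_le (s + t) (- t).
rewrite addrK normrN in h2; rewrite !ger0_norm // in h1 h2.
have e : expR t * expR (- t) = 1 by rewrite -expRD subrr expR0.
have et := expR_gt0 t; have et' := expR_gt0 (- t).
set a := chh s in h1 h2 *; set b := chh (s + t) in h1 h2 *.
have h3 : expR (- t) * a <= b.
  rewrite -(ler_pM2l et) mulrA e mul1r //.
have : (b - expR t * a) * (b - expR (- t) * a) <= 0.
  by rewrite mulr_le0_ge0 ?subr_le0 ?subr_ge0.
have : (b - expR t * a) * (b - expR (- t) * a) =
   b ^+ 2 - chh t * (a * b) + (expR t * expR (- t)) * a ^+ 2 by rewrite /chh; ring.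
rewrite e => ->; lra.
Qed.

Lemma chh_sqr s : chh s ^+ 2 <= 2 * chh (2 * s).
Proof.
have := expR_gt0 s; have := expR_gt0 (- s).
have e : expR s * expR (- s) = 1 by rewrite -expRD subrr expR0.
have -> : chh (2 * s) = expR s ^+ 2 + expR (- s) ^+ 2.
  by rewrite /chh !expr2 -!expRD; congr (expR _ + expR _); ring.
by rewrite /chh => _ _; have := sqr_ge0 (expR s - expR (- s)); nra.
Qed.

Lemma expR_sub1_le s : 0 <= s <= 1 / 2 -> expR s - 1 <= 2 * s.
Proof.
move=> /andP[s0 s1]; have e : expR s * expR (- s) = 1 by rewrite -expRD subrr expR0.
by have := expR_ge1Dx (- s); have := expR_gt0 s; nra.
Qed.

End CoshWeight.

Section Weight.
Variables (R : realType) (d N n : nat).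
Hypotheses (n_gt0 : (0 < n)%N).
Local Notation T := (Pt d N).
Implicit Types (x y : T) (mu nu : 'I_d) (kappa : R).

Definition phi kappa (i j : 'I_N) : R := chh (kappa * (j%:R - i%:R) / n%:R).

Definition weight kappa x0 x : R := \prod_mu phi kappa (x0 mu) (x mu).

Let np : 0 < n%:R :> R. Proof. by rewrite ltr0n. Qed.
Let nz : n%:R != 0 :> R. Proof. by rewrite gt_eqF. Qed.
Let n1 : 1 <= n%:R :> R. Proof. by rewrite ler1n. Qed.

Lemma weight_gt0 kappa x0 x : 0 < weight kappa x0 x.
Proof. by apply: prodr_gt0 => mu _; exact: chh_gt0. Qed.

Lemma weight_upd kappa x0 x mu : exists2 r, 0 < r &
  weight kappa x0 x = phi kappa (x0 mu) (x mu) * r /\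
  forall j, weight kappa x0 (upd x mu j) = phi kappa (x0 mu) j * r.
Proof.
exists (\prod_(nu | nu != mu) phi kappa (x0 nu) (x nu)).
  by apply: prodr_gt0 => nu _; exact: chh_gt0.
split=> [|j]; rewrite /weight (bigD1 mu) //= ?upd_same; congr (_ * _).
by apply: eq_bigr => nu h; rewrite upd_other.
Qed.

Lemma phi_osucc kappa i j : osucc j != j ->
  phi kappa i (osucc j) = chh (kappa * (j%:R - i%:R) / n%:R + kappa / n%:R).
Proof.
move=> h; rewrite /phi; congr chh.
have -> : nat_of_ord (osucc j) = j.+1.
  by move: h; rewrite -val_eqE /= val_osucc; case: ifP; rewrite ?eqxx.
by rewrite -natr1; field.
Qed.

Lemma phi_opred kappa i j : opred j != j ->
  phi kappa i (opred j) = chh (kappa * (j%:R - i%:R) / n%:R - kappa / n%:R).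
Proof.
move=> h; rewrite /phi; congr chh.
have e : nat_of_ord j = (opred j).+1.
  by move: h; rewrite -val_eqE /= val_opred; case: (nat_of_ord j) => //=; rewrite eqxx.
by rewrite e -natr1; field.
Qed.

Section Small.
Variable (kappa : R).
Hypothesis kappa01 : 0 <= kappa <= 1.
Variable x0 : T.
Local Notation W := (weight kappa x0).

Let k0 : 0 <= kappa. Proof. by case/andP: kappa01. Qed.
Let t01 : 0 <= kappa / n%:R <= 1.
Proof.
case/andP: kappa01 => h0 h1; rewrite divr_ge0 ?ler0n //=.
by rewrite ler_pdivrMr // mul1r; apply: le_trans n1.
Qed.
Let step : n%:R ^+ 2 * (chh (kappa / n%:R) - 2) <= 4 * kappa ^+ 2.
Proof.
have -> : 4 * kappa ^+ 2 = n%:R ^+ 2 * (4 * (kappa / n%:R) ^+ 2) by field.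
by rewrite ler_pM2l ?exprn_gt0 //; exact: chh_sub2_le.
Qed.

Lemma weight_bond mu x :
  n%:R ^+ 2 * (W (sp mu x) - W x) ^+ 2 <= 4 * kappa ^+ 2 * (W (sp mu x) * W x).
Proof.
case: (eqVneq (osucc (x mu)) (x mu)) => [e|ne].
  rewrite /sp e upd_id subrr expr0n /= mulr0.
  by rewrite mulr_ge0 ?mulr_ge0 ?sqr_ge0 // ltW // weight_gt0.
have [r r0 [eW eU]] := weight_upd kappa x0 x mu.
rewrite /sp eU eW phi_osucc // -mulrBl.
have c0 := chh_gt0 (kappa * ((x mu)%:R - (x0 mu)%:R) / n%:R).
have c0' := chh_gt0 (kappa * ((x mu)%:R - (x0 mu)%:R) / n%:R + kappa / n%:R).
have h := chh_ratio (kappa * ((x mu)%:R - (x0 mu)%:R) / n%:R) (proj1 (andP t01)).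
rewrite /phi; set a := chh (_ / _) in c0 h *; set b := chh (_ + _) in c0' h *.
have -> : n%:R ^+ 2 * ((b - a) * r) ^+ 2 = n%:R ^+ 2 * (b - a) ^+ 2 * r ^+ 2 by ring.
have -> : 4 * kappa ^+ 2 * (b * r * (a * r)) = 4 * kappa ^+ 2 * (b * a) * r ^+ 2 by ring.
rewrite ler_wpM2r ?sqr_ge0 //.
apply: le_trans (_ : n%:R ^+ 2 * ((chh (kappa / n%:R) - 2) * (b * a)) <= _).
  by rewrite ler_pM2l ?exprn_gt0.
by rewrite mulrA ler_wpM2r // mulr_ge0 // ltW.
Qed.

(** Away from the faces this is the eigenfunction identity. At a face the clamped value [chh s]
    replaces one farther from the centre, because [x0] lies in the box, so the Neumann rule only
    lowers the left side. *)
Lemma weight_nbrs mu x : W (sp mu x) + W (sm mu x) <= chh (kappa / n%:R) * W x.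
Proof.
have [r r0 [eW eU]] := weight_upd kappa x0 x mu.
rewrite /sp /sm !eU eW -mulrDl mulrA ler_wpM2r ?(ltW r0) //.
set s := kappa * ((x mu)%:R - (x0 mu)%:R) / n%:R.
rewrite -[phi _ _ (x mu)]/(chh s) -chh_addsub; apply: lerD.
  case: (eqVneq (osucc (x mu)) (x mu)) => [e|ne]; last by rewrite phi_osucc.
  rewrite e -[phi _ _ (x mu)]/(chh s) chh_le //; last by case/andP: t01.
  rewrite /s divr_ge0 ?mulr_ge0 ?ler0n // subr_ge0 ler_nat.
  move/(congr1 (@nat_of_ord N)): e; rewrite val_osucc; have := ltn_ord (x0 mu).
  by case: ifP; lia.
case: (eqVneq (opred (x mu)) (x mu)) => [e|ne]; last by rewrite phi_opred.
rewrite e -[phi _ _ (x mu)]/(chh s) -(chhN s) -(chhN (s - _)) opprB addrC chh_le //.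
  rewrite /s -mulNr -mulrN opprB divr_ge0 ?mulr_ge0 ?ler0n // subr_ge0 ler_nat.
  by move/(congr1 (@nat_of_ord N)): e; rewrite val_opred; lia.
by case/andP: t01.
Qed.

Lemma weight_barrier c x : 1 <= c -> 4 * d%:R * kappa ^+ 2 <= 1 / 2 -> W x / 2 <= Bop n c W x.
Proof.
move=> c1 small; have W0 := weight_gt0 kappa x0 x.
have h mu : - (4 * kappa ^+ 2) * W x <= lap n mu W x.
  have := weight_nbrs mu x => hn; rewrite /lap.
  apply: le_trans (_ : n%:R ^+ 2 * ((2 - chh (kappa / n%:R)) * W x) <= _); last first.
    by rewrite ler_pM2l ?exprn_gt0 //; lra.
  by rewrite mulrA ler_wpM2r ?(ltW W0) //; have := step; lra.
rewrite /Bop; have hs : d%:R * (- (4 * kappa ^+ 2) * W x) <= \sum_mu lap n mu W x.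
  by rewrite mulr_natl -[d in X in X <= _]card_ord -sumr_const; apply: ler_sum.
have h1 : 1 * W x <= c * W x by rewrite ler_wpM2r // ltW.
have h2 : (4 * d%:R * kappa ^+ 2) * W x <= 1 / 2 * W x by rewrite ler_wpM2r // ltW.
by lra.
Qed.

Lemma weight_block x y : same_block n x y -> W y <= expR (kappa * d%:R) * W x.
Proof.
move=> /forallP xy; have -> : expR (kappa * d%:R) = \prod_(mu < d) expR kappa.
  by rewrite prodr_const card_ord mulrC expRM_natl.
rewrite /weight -big_split /=; apply: ler_prod => mu _; rewrite ltW ?chh_gt0 //=.
have -> : phi kappa (x0 mu) (y mu) =
   chh (kappa * ((x mu)%:R - (x0 mu)%:R) / n%:R + kappa * ((y mu)%:R - (x mu)%:R) / n%:R).
  by rewrite /phi; congr chh; field.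
apply: le_trans (chhD_le _ _) _; rewrite ler_wpM2r ?(ltW (chh_gt0 _)) //.
rewrite ler_expR normrM normfV (gtr0_norm np) ler_pdivrMr // normrM (ger0_norm k0).
rewrite ler_wpM2l // ler_norml.
have e := eqP (xy mu); have d1 := divn_eq (x mu) n; have d2 := divn_eq (y mu) n.
have m1 := ltn_pmod (x mu) n_gt0; have m2 := ltn_pmod (y mu) n_gt0.
rewrite e in d2; apply/andP; split; last by rewrite lerBlDr -natrD ler_nat; lia.
by rewrite lerNl opprB lerBlDr -natrD ler_nat; lia.
Qed.

Lemma weight_block_norm x y : kappa * d%:R <= 1 / 2 -> same_block n x y ->
  `|W y - W x| <= 2 * (kappa * d%:R) * W x.
Proof.
move=> small xy; have h1 := weight_block xy.
have h2 : W x <= expR (kappa * d%:R) * W y by apply: weight_block; rewrite same_block_sym.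
have kd : 0 <= kappa * d%:R by rewrite mulr_ge0 ?ler0n.
have h3 : expR (kappa * d%:R) - 1 <= 2 * (kappa * d%:R) by apply: expR_sub1_le; rewrite kd.
have e1 : 1 <= expR (kappa * d%:R) by have := expR_ge1Dx (kappa * d%:R); lra.
have W0 := weight_gt0 kappa x0 x; have W0' := weight_gt0 kappa x0 y.
have h4 : (expR (kappa * d%:R) - 1) * W x <= 2 * (kappa * d%:R) * W x by rewrite ler_wpM2r // ltW.
rewrite ler_norml; apply/andP; split; last by lra.
rewrite lerNl opprB; apply: le_trans h4; set E := expR _ in h1 h2 h3 e1 *.
case: (lerP (W x) (W y)) => h5; first by rewrite (@le_trans _ _ 0) ?subr_le0 // mulr_ge0 ?subr_ge0 // ltW.
have : (E - 1) * W y <= (E - 1) * W x by rewrite ler_wpM2l ?subr_ge0 // ltW.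
by lra.
Qed.

Lemma weight_center : W x0 = 2 ^+ d.
Proof.
rewrite /weight (eq_bigr (fun=> 2)) ?prodr_const ?card_ord // => mu _.
by rewrite /phi subrr mulr0 mul0r chh0.
Qed.

(** Cauchy-Schwarz will produce [W^2]; doubling the rate makes it a weight again, to which the
    barrier applies. *)
Lemma weight_sqr x : W x ^+ 2 <= 2 ^+ d * weight (2 * kappa) x0 x.
Proof.
have -> : 2 ^+ d = \prod_(mu < d) (2 : R) by rewrite prodr_const card_ord.
rewrite /weight -prodrXl -big_split /=; apply: ler_prod => mu _; rewrite sqr_ge0 /=.
apply: le_trans (chh_sqr _) _; by rewrite /phi !mulrA.
Qed.

End Small.
End Weight.

(** * The bound for real data *)

Section WeightSums.
Variables (R : realType) (d N n : nat).
Hypotheses (n_gt0 : (0 < n)%N).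
Local Notation T := (Pt d N).

Lemma sqrt_sum_sqr_le (I : finType) (a : I -> R) :
  Num.sqrt (\sum_i a i ^+ 2) <= \sum_i `|a i|.
Proof.
have S0 : 0 <= \sum_i `|a i| by apply: sumr_ge0.
rewrite -[leRHS]ger0_norm // -sqrtr_sqr ler_wsqrtr // expr2 mulr_suml.
apply: ler_sum => i _; rewrite -real_normK ?num_real // expr2 ler_wpM2l //.
by rewrite (bigD1 i) //= lerDl sumr_ge0.
Qed.

(** A product of one-dimensional weights sees the l1 distance, which dominates the Euclidean one. *)
Lemma weight_dist (kappa : R) (x0 x : T) : 0 <= kappa ->
  expR (kappa * (n%:R^-1 * Num.sqrt (\sum_mu ((x0 mu)%:R - (x mu)%:R) ^+ 2))) <=
  weight n kappa x0 x.
Proof.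
move=> k0; apply: le_trans (_ : expR (\sum_mu `|kappa * ((x mu)%:R - (x0 mu)%:R) / n%:R|) <= _).
  rewrite ler_expR.
  have -> : \sum_mu `|kappa * ((x mu)%:R - (x0 mu)%:R) / n%:R| =
     kappa * (n%:R^-1 * \sum_mu `|(x0 mu)%:R - (x mu)%:R|) :> R.
    rewrite !mulr_sumr; apply: eq_bigr => mu _.
    rewrite !normrM (ger0_norm k0) (distrC (x0 mu)%:R) normfV normr_nat.
    by rewrite mulrC mulrCA.
  by rewrite ler_wpM2l // ler_wpM2l ?invr_ge0 ?ler0n // sqrt_sum_sqr_le.
rewrite expR_sum; apply: ler_prod => mu _; rewrite expR_ge0 /=.
exact: expR_norm_le_chh.
Qed.

(** The exponent is [|j - j0|] written with truncated subtraction. The factor [1 - q] stays on the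
    left to avoid a division. *)
Lemma geometric_two_sided (q : R) (j0 M : nat) : 0 <= q <= 1 ->
  (1 - q) * \sum_(0 <= j < M) q ^+ ((j - j0) + (j0 - j)) <= 2.
Proof.
move=> /andP[q0 q1].
have A m : (m <= j0)%N -> (1 - q) * \sum_(0 <= j < m) q ^+ ((j - j0) + (j0 - j)) <= q ^+ (j0.+1 - m).
  elim: m => [|m IH] h; first by rewrite big_geq // mulr0 exprn_ge0.
  rewrite big_nat_recr //= mulrDr; apply: le_trans (lerD (IH (ltnW h)) (lexx _)) _.
  have -> : (m - j0 + (j0 - m) = j0 - m)%N by lia.
  have -> : (j0.+1 - m = (j0 - m).+1)%N by lia.
  by rewrite subSS exprS; lra.
have B m : (1 - q) * \sum_(0 <= j < j0 + m) q ^+ ((j - j0) + (j0 - j)) <= 2 - q ^+ m.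
  elim: m => [|m IH].
    rewrite addn0; apply: le_trans (A _ (leqnn _)) _.
    by rewrite subSn // subnn expr1 expr0; lra.
  rewrite addnS big_nat_recr //= mulrDr; apply: le_trans (lerD IH (lexx _)) _.
  have -> : (j0 + m - j0 + (j0 - (j0 + m)) = m)%N by lia.
  by rewrite exprS; lra.
have qM m : 0 <= q ^+ m <= 1 by rewrite exprn_ge0 ?exprn_ile1.
case: (leqP M j0) => h; first by apply: le_trans (A _ h) _; have /andP[_] := qM (j0.+1 - M)%N; lra.
rewrite -(subnKC (ltnW h)); apply: le_trans (B _) _.
by have /andP[] := qM (M - j0)%N; lra.
Qed.

(** There are of order [n / kappa] sites within the decay length. Quantitatively, [q * (1 + t) <= 1]
    gives [t <= (1 - q) * (1 + t)], which converts the geometric bound. *)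
Lemma sum_phi_inv (kappa : R) (i : 'I_N) : 0 < kappa ->
  \sum_(j < N) (phi n kappa i j)^-1 <= 2 * (kappa^-1 + 1) * n%:R.
Proof.
move=> k0; have np : 0 < n%:R :> R by rewrite ltr0n.
have n1 : 1 <= n%:R :> R by rewrite ler1n.
pose t := kappa / n%:R; have t0 : 0 < t by rewrite divr_gt0.
pose q := expR (- t).
have q1 : q < 1 by rewrite expR_lt1 oppr_lt0.
have q0 : 0 < q := expR_gt0 _.
have hq : q * (1 + t) <= 1.
  have e : expR t * q = 1 by rewrite -expRD subrr expR0.
  rewrite mulrC in e; apply: le_trans (_ : q * expR t <= 1); last by rewrite e.
  by rewrite ler_pM2l // expR_ge1Dx.
have h1 j : (phi n kappa i j)^-1 <= q ^+ ((j - i) + (i - j)).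
  rewrite /q -expRM_natl -[leRHS]invrK lef_pV2 ?posrE ?chh_gt0 ?invr_gt0 ?expR_gt0 //.
  rewrite -expRN mulrN opprK; apply: le_trans (expR_norm_le_chh _); rewrite ler_expR.
  rewrite !normrM normfV (gtr0_norm np) (gtr0_norm k0) /t mulrCA mulrA ler_wpM2r ?invr_ge0 ?(ltW np) //.
  rewrite ler_wpM2l ?(ltW k0) //.
  case: (leqP j i) => h.
    by rewrite (eqP h) add0n natrB // distrC ler_norm.
  by rewrite (eqP (ltnW h)) addn0 natrB 1?ltnW // ler_norm.
apply: le_trans (ler_sum _ (fun j _ => h1 j)) _.
rewrite -(big_mkord xpredT (fun j => q ^+ ((j - i) + (i - j)))).
have q01 : 0 <= q <= 1 by rewrite !ltW.
have := geometric_two_sided i N q01; set S := \sum_(_ <= _ < _) _ => hS.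
have S0 : 0 <= S by apply: sumr_ge0 => j _; rewrite exprn_ge0 // ltW.
have h2 : t * S <= 2 * (1 + t).
  have : t <= (1 - q) * (1 + t) by lra.
  move=> /(ler_wpM2r S0) h; apply: le_trans h _.
  by rewrite mulrAC ler_wpM2r //; lra.
have -> : S = t^-1 * (t * S) by rewrite mulKf // gt_eqF.
apply: le_trans (_ : t^-1 * (2 * (1 + t)) <= _).
  by rewrite ler_wpM2l // invr_ge0 ltW.
have -> : t^-1 * (2 * (1 + t)) = 2 * (kappa^-1 * n%:R + 1).
  by rewrite /t; field; rewrite !gt_eqF.
by lra.
Qed.

Lemma sum_weight_inv (kappa : R) (x0 : T) : 0 < kappa ->
  \sum_x (weight n kappa x0 x)^-1 <= (2 * (kappa^-1 + 1)) ^+ d * n%:R ^+ d.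
Proof.
move=> k0; rewrite -exprMn.
have -> : \sum_x (weight n kappa x0 x)^-1 = \prod_mu \sum_(j < N) (phi n kappa (x0 mu) j)^-1.
  by rewrite bigA_distr_bigA /=; apply: eq_bigr => x _; rewrite /weight prodfV.
rewrite -[d in leRHS]card_ord -prodr_const; apply: ler_prod => mu _.
rewrite sum_phi_inv // andbT; apply: sumr_ge0 => j _.
by rewrite invr_ge0 ltW // chh_gt0.
Qed.

End WeightSums.

Section RealBound.
Variables (R : realType) (d N n : nat) (a al m2 : R).
Hypotheses (d_gt0 : (0 < d)%N) (n_gt0 : (0 < n)%N) (n_dvd : (n %| N)%N).
Hypotheses (a01 : 0 < a <= 1) (al_bounds : a / 2 <= al <= 1) (m2_ge0 : 0 <= m2).
Local Notation T := (Pt d N).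
Implicit Types (x y : T) (f u : T -> R).

(* Small enough for the conjugation errors in [weighted_l2] and for
   [weight_barrier] at the doubled rate [2 * rate]. *)
Definition rate : R := a / (16 * d%:R).
(* Bounds [eta^d * sum_x (u x / W x)^2] relative to [(|f|_oo * decay)^2]. *)
Definition Kc : R := 16 / a ^+ 2 * (2 * (rate^-1 + 1)) ^+ d.

Let d1 : 1 <= d%:R :> R. Proof. by rewrite ler1n. Qed.
Let a0 : 0 < a. Proof. by case/andP: a01. Qed.
Let a1 : a <= 1. Proof. by case/andP: a01. Qed.

Lemma rate_gt0 : 0 < rate. Proof. by rewrite divr_gt0 // mulr_gt0 // ltr0n. Qed.

Lemma rate_d : rate * d%:R = a / 16.
Proof. by rewrite /rate; field; rewrite gt_eqF // ltr0n. Qed.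

Lemma Kc_ge0 : 0 <= Kc.
Proof.
have := rate_gt0; rewrite -invr_gt0 /Kc => h.
apply: mulr_ge0; first by rewrite divr_ge0 ?sqr_ge0.
by apply: exprn_ge0; apply: mulr_ge0 => //; lra.
Qed.

Let rate_le : rate <= a / 16.
Proof. by rewrite -rate_d ler_peMr // ltW // rate_gt0. Qed.

Let rate2_d : d%:R * rate ^+ 2 <= a ^+ 2 / 256.
Proof.
have -> : d%:R * rate ^+ 2 = rate * (rate * d%:R) by ring.
rewrite rate_d; have h : rate * (a / 16) <= a / 16 * (a / 16).
  by rewrite ler_wpM2r // ltW // divr_gt0.
by lra.
Qed.

Let a2 : a ^+ 2 <= a. Proof. by rewrite expr2 ler_piMl // ltW. Qed.

Section Solution.
Variables (u : T -> R) (x0 : T) (F D : R).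
Local Notation f := (Areal n al m2 u).
Local Notation W := (weight n rate x0).
Hypotheses (f_le : forall x, `|f x| <= F).
Hypotheses (f_supp : forall x, f x != 0 ->
  D <= n%:R^-1 * Num.sqrt (\sum_mu ((x0 mu)%:R - (x mu)%:R) ^+ 2)).

Let E : R := expR (- (rate / 2) * D).
Let c : R := 1 + m2.
Let c1 : 1 <= c. Proof. by rewrite /c lerDl. Qed.
Let np : 0 < n%:R :> R. Proof. by rewrite ltr0n. Qed.
Let F0 : 0 <= F. Proof. exact: le_trans (normr_ge0 _) (f_le x0). Qed.
Let E0 : 0 < E. Proof. exact: expR_gt0. Qed.
Let W0 x : 0 < W x. Proof. exact: weight_gt0. Qed.
Let r0 : 0 < rate. Proof. exact: rate_gt0. Qed.
Let r01 : 0 <= rate <= 1.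
Proof. by rewrite ltW //=; have := rate_le; have := a1; lra. Qed.

(** The second bound explains the halved rate: on the support it gives [f^2 / W^2 <= (F E)^2 / W],
    where one factor [1 / W] is left to be summed over the lattice. *)
Let supp_weight x : f x != 0 -> 1 <= E * W x /\ 1 <= E ^+ 2 * W x.
Proof.
move=> /f_supp; set D' := _ * _ => hD.
have D'0 : 0 <= D' by rewrite mulr_ge0 ?invr_ge0 ?ler0n ?sqrtr_ge0.
have hW : expR (rate * D') <= W x by apply: weight_dist => //; exact: ltW.
have h1 : rate * D <= rate * D' by rewrite ler_pM2l.
have h2 : 0 <= rate * D' by rewrite mulr_ge0 // ltW.
split.
  apply: le_trans (_ : E * expR (rate * D') <= _); last by rewrite ler_pM2l.
  by rewrite /E -expRD -[leLHS]expR0 ler_expR; lra.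
apply: le_trans (_ : E ^+ 2 * expR (rate * D') <= _); last by rewrite ler_pM2l // exprn_gt0.
by rewrite /E expr2 -!expRD -[leLHS]expR0 ler_expR; lra.
Qed.

Let f_weight x : `|f x| <= F * E * W x.
Proof.
case: (eqVneq (f x) 0) => [->|ne].
  by rewrite normr0 !mulr_ge0 // ltW.
have [h _] := supp_weight ne; apply: le_trans (f_le x) _.
by rewrite -mulrA ler_peMr.
Qed.

Let f_l2 : \sum_x (f x / W x) ^+ 2 <= (F * E) ^+ 2 * (2 * (rate^-1 + 1)) ^+ d * n%:R ^+ d.
Proof.
apply: le_trans (_ : \sum_x (F * E) ^+ 2 * (W x)^-1 <= _); last first.
  by rewrite -mulr_sumr -mulrA ler_wpM2l ?sqr_ge0 // sum_weight_inv.
apply: ler_sum => x _; have p := W0 x.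
case: (eqVneq (f x) 0) => [->|ne].
  by rewrite mul0r expr0n /= mulr_ge0 ?sqr_ge0 // invr_ge0 ltW.
have [_ h] := supp_weight ne.
rewrite expr_div_n; have -> : (F * E) ^+ 2 / W x = F ^+ 2 * (E ^+ 2 * W x) / W x ^+ 2.
  by field; rewrite gt_eqF.
rewrite ler_wpM2r ?invr_ge0 ?sqr_ge0 //.
apply: le_trans (_ : F ^+ 2 <= _); last by rewrite ler_peMr // sqr_ge0.
by rewrite -real_normK ?num_real // ler_pXn2r ?nnegrE.
Qed.

Let u_l2 : \sum_x (u x / W x) ^+ 2 <= Kc * (F * E) ^+ 2 * n%:R ^+ d.
Proof.
have k0 := ltW r0.
(* Since [rate * d = a / 16], the block error is [a / 8] and the bond error at most [a / 64], within
   the allowed [a / 4]. *)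
apply: le_trans (@weighted_l2 R d N n n_gt0 n_dvd W rate (2 * (rate * d%:R)) W0
  _ _ _ a al m2 u a0 al_bounds m2_ge0 _) _.
- by apply: mulr_ge0 => //; apply: mulr_ge0 => //; exact: ler0n.
- by move=> mu x; apply: weight_bond.
- by move=> x y; apply: weight_block_norm => //; rewrite rate_d; have := a1; lra.
- by rewrite rate_d; have := rate2_d; have := a2; have := a0; have := a1; lra.
have -> : Kc * (F * E) ^+ 2 * n%:R ^+ d =
  16 / a ^+ 2 * ((F * E) ^+ 2 * (2 * (rate^-1 + 1)) ^+ d * n%:R ^+ d).
  by rewrite /Kc; set S := (2 * _) ^+ d; ring.
by rewrite ler_wpM2l // divr_ge0 ?sqr_ge0.
Qed.

(* [1 + Kc] replaces [sqrt Kc]. *)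
Let sqr_le_lin (X Y : R) : 0 <= Y -> X ^+ 2 <= Kc * Y ^+ 2 -> `|X| <= (1 + Kc) * Y.
Proof.
have K0 := Kc_ge0; move=> Y0 h.
rewrite -(ler_pXn2r (n := 2)) ?nnegrE ?mulr_ge0 ?addr_ge0 //.
rewrite real_normK ?num_real //; apply: le_trans h _.
by rewrite exprMn ler_wpM2r ?sqr_ge0 //; nra.
Qed.

(** The normalization [n^-d] of the average cancels the [n^d] in [u_l2], and [W] varies by a factor
    at most 2 on a block. *)
Let bavg_u x : `|bavg n u x| <= (1 + Kc) * (2 * (F * E * W x)).
Proof.
have p := W0 x.
apply: sqr_le_lin; first by rewrite !mulr_ge0 // ltW.
apply: le_trans (bavg_sqr_le n_gt0 n_dvd _ _) _; rewrite /bavg.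
have e2 : expR (rate * d%:R) <= 2.
  have := @expR_sub1_le R (rate * d%:R); rewrite rate_d => h; have := h; have := a0; have := a1; lra.
apply: le_trans (_ : n%:R ^- d * (4 * W x ^+ 2 * \sum_y (u y / W y) ^+ 2) <= _).
  rewrite ler_wpM2l ?invr_ge0 ?exprn_ge0 ?ler0n // mulr_sumr.
  apply: le_trans (_ : \sum_(y | same_block n x y) 4 * W x ^+ 2 * (u y / W y) ^+ 2 <= _); last first.
    apply: ler_sum_sub => // y; apply: mulr_ge0; last exact: sqr_ge0.
    by apply: mulr_ge0 => //; exact: sqr_ge0.
  apply: ler_sum => y xy; have p' := W0 y.
  rewrite expr_div_n mulrCA ler_peMr ?sqr_ge0 // ler_pdivlMr ?exprn_gt0 // mul1r.
  have -> : 4 * W x ^+ 2 = (2 * W x) ^+ 2 by ring.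
  rewrite ler_pXn2r ?nnegrE ?mulr_ge0 ?(ltW p) ?(ltW p') //.
  apply: le_trans (weight_block n_gt0 r01 x0 xy) _.
  by rewrite ler_wpM2r // ltW.
rewrite ler_pdivrMl ?exprn_gt0 //.
have -> : n%:R ^+ d * (Kc * (2 * (F * E * W x)) ^+ 2) =
  4 * W x ^+ 2 * (Kc * (F * E) ^+ 2 * n%:R ^+ d) by ring.
by rewrite ler_wpM2l // mulr_ge0 ?sqr_ge0.
Qed.

Let g x := f x - al * bavg n u x.

Let g_weight x : `|g x| <= (3 + 2 * Kc) * (F * E) * W x.
Proof.
have h1 := f_weight x; have h2 := bavg_u x; case/andP: al_bounds => al1 al2.
apply: le_trans (ler_normB _ _) _; rewrite normrM ger0_norm; last by have := a0; lra.
have h3 : al * `|bavg n u x| <= 1 * `|bavg n u x| by rewrite ler_wpM2r.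
by lra.
Qed.

Let Bop_u x : Bop n c u x = g x + u x.
Proof. by rewrite /Bop /g /Areal /c; ring. Qed.

Let u_step i : \sum_x ker n c i x0 x * u x =
  \sum_x ker n c i.+1 x0 x * u x + \sum_x ker n c i.+1 x0 x * g x.
Proof.
rewrite -[in LHS](res_Bop n c1 u) (res_sym n c1) -big_split /=.
by apply: eq_bigr => x _; rewrite Bop_u; ring.
Qed.

Let u_expand m : u x0 = \sum_x ker n c m x0 x * u x +
  \sum_(i < m) \sum_x ker n c i.+1 x0 x * g x.
Proof.
elim: m => [|m IH]; last by rewrite IH u_step big_ord_recr /=; ring.
by rewrite big_ord0 addr0 -[LHS]sum_delta; apply: eq_bigr => x _; rewrite mulrC.
Qed.

Let barrier x : W x / 2 <= Bop n c W x.
Proof. by apply: weight_barrier => //; have := rate2_d; have := a2; have := a1; lra. Qed.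

(** One factor [2^d] is [W x0]; the other bounds the doublings by at most [d] resolvents. *)
Let ker_g i : (i < d)%N ->
  `|\sum_x ker n c i.+1 x0 x * g x| <= 4 ^+ d * ((3 + 2 * Kc) * (F * E)).
Proof.
move=> id; have K0 := Kc_ge0.
set K := (3 + 2 * Kc) * (F * E); have Kp : 0 <= K.
  by apply: mulr_ge0; [lra | exact: mulr_ge0 F0 (ltW E0)].
apply: le_trans (ler_norm_sum _ _ _) _.
apply: le_trans (_ : \sum_x K * (ker n c i.+1 x0 x * W x) <= _).
  apply: ler_sum => x _; rewrite normrM ger0_norm ?ker_ge0 // mulrCA.
  by rewrite ler_wpM2l ?ker_ge0.
rewrite -mulr_sumr mulrC ler_wpM2r //.
apply: le_trans (sum_ker_le c1 _ _ barrier) _; rewrite weight_center.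
have -> : 4 ^+ d = 2 ^+ d * 2 ^+ d :> R by rewrite -exprMn; congr (_ ^+ _); ring.
by rewrite ler_wpM2r ?exprn_ge0 // ler_weXn2l // ler1n.
Qed.

(** In the square of [ker * W] one kernel factor is bounded by its supremum, and the other is summed
    against the weight of doubled rate. The [n^-d] from the supremum cancels the [n^d] of [u_l2]. *)
Let ker_u : `|\sum_x ker n c d x0 x * u x| <= (1 + Kc) * (4 ^+ d * (F * E)).
Proof.
apply: sqr_le_lin; first by rewrite !mulr_ge0 ?exprn_ge0 // ltW.
have -> : \sum_x ker n c d x0 x * u x = \sum_x (ker n c d x0 x * W x) * (u x / W x).
  by apply: eq_bigr => x _; field; rewrite gt_eqF.
apply: le_trans (cauchy_schwarz _ _) _.
have h : \sum_x (ker n c d x0 x * W x) ^+ 2 <= 16 ^+ d * n%:R ^- d.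
  apply: le_trans (_ : \sum_x 2 ^+ d * n%:R ^- d * 2 ^+ d * (ker n c d x0 x * weight n (2 * rate) x0 x) <= _).
    apply: ler_sum => x _; have k0 := ker_ge0 n c1 d x0 x.
    rewrite exprMn.
    have -> : 2 ^+ d * n%:R ^- d * 2 ^+ d * (ker n c d x0 x * weight n (2 * rate) x0 x) =
       (2 ^+ d * n%:R ^- d * ker n c d x0 x) * (2 ^+ d * weight n (2 * rate) x0 x) by ring.
    apply: ler_pM; rewrite ?sqr_ge0 ?weight_sqr //.
    by rewrite expr2 ler_wpM2r // ker_sup.
  have h := @sum_ker_le _ _ _ n c c1 d x0 (weight n (2 * rate) x0).
  rewrite -mulr_sumr.
  (* The four factors [2^d] come from [ker_sup], [weight_sqr], the [d] resolvents, and the weight at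
     its centre. *)
  have -> : 16 ^+ d * n%:R ^- d = 2 ^+ d * n%:R ^- d * 2 ^+ d * (2 ^+ d * 2 ^+ d) :> R.
    have -> : 16 ^+ d = 2 ^+ d * 2 ^+ d * (2 ^+ d * 2 ^+ d) :> R.
      by rewrite -!exprMn; congr (_ ^+ _); ring.
    by ring.
  rewrite ler_wpM2l ?mulr_ge0 ?invr_ge0 ?exprn_ge0 ?ler0n //.
  rewrite -[X in _ <= _ * X](weight_center n (2 * rate) x0); apply: h => x.
  apply: weight_barrier => //; last by rewrite exprMn; have := rate2_d; have := a2; have := a1; lra.
  by rewrite mulr_ge0 ?(ltW r0) //=; have := rate_le; have := a1; lra.
apply: le_trans (ler_pM _ _ h u_l2) _; try by apply: sumr_ge0 => x _; exact: sqr_ge0.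
rewrite le_eqVlt; apply/orP; left; apply/eqP.
have -> : 16 ^+ d = 4 ^+ d * 4 ^+ d :> R by rewrite -exprMn; congr (_ ^+ _); ring.
by field; rewrite expf_neq0 // gt_eqF.
Qed.

Lemma solution_bound :
  `|u x0| <= 4 ^+ d * ((1 + Kc) + d%:R * (3 + 2 * Kc)) * F * E.
Proof.
rewrite (u_expand d); apply: le_trans (ler_normD _ _) _.
apply: le_trans (lerD ker_u (ler_norm_sum _ _ _)) _.
apply: le_trans (lerD (lexx _) (ler_sum _ (fun i _ => ker_g (ltn_ord i)))) _.
rewrite sumr_const card_ord -[X in _ + X]mulr_natl.
by rewrite le_eqVlt; apply/orP; left; apply/eqP; ring.
Qed.

End Solution.
End RealBound.

(** * Reduction of the complex operator to the real one *)

Section ComplexToReal.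
Variables (R : realType) (d : nat).
Local Open Scope complex_scope.
Local Notation normc := ComplexField.Normc.normc.

Lemma normc_real (r : R) : normc r%:C = `|r|.
Proof. by rewrite /= expr0n addr0 sqrtr_sqr. Qed.

Lemma normc_ge0 (z : R[i]) : 0 <= normc z.
Proof. by case: z => u v; exact: sqrtr_ge0. Qed.

Lemma le_normc_sum (I : finType) (F : I -> R[i]) : normc (\sum_i F i) <= \sum_i normc (F i).
Proof.
elim/big_ind2: _ => [|x1 x2 y1 y2 h1 h2|//]; first by rewrite ComplexField.Normc.normc0.
exact: le_trans (le_normcD _ _) (lerD h1 h2).
Qed.

Lemma nval_plus N (f : Pt d N -> R[i]) x mu : nval f x (nbr_plus x mu) = f (sp mu x).
Proof.
rewrite /nbr_plus /sp /osucc; case: insubP => [j _ _|_] //=.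
by rewrite upd_id.
Qed.

Lemma nval_minus N (f : Pt d N -> R[i]) x mu : nval f x (nbr_minus x mu) = f (sm mu x).
Proof.
rewrite /nbr_minus; case: ifP => [_|/negbT h]; last by rewrite (sm_bot h).
rewrite /sm /opred; case: insubP => [j _ _|_] //=.
by rewrite upd_id.
Qed.

Variables (L k m : nat) (a mu0 : R).
Hypotheses (L_gt1 : (1 < L)%N) (k_gt0 : (0 < k)%N) (km : (k <= m)%N).
Local Notation T := (Pt d (L ^ m)).
Local Notation A := (Areal (d := d) (N := L ^ m) (L ^ k) (a_j a L k) (mubar_j mu0 L k)).

Lemma eta_inv : eta R L k = (L ^ k)%:R^-1.
Proof. by rewrite /eta exprVn natrX. Qed.

Lemma Aop_real (g : T -> R) x : Aop a mu0 L k (fun y => (g y)%:C) x = (A g x)%:C.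
Proof.
rewrite /Aop /Areal !rmorphD /=; congr (_ + _ + _); last 2 first.
- by rewrite rmorphM.
- rewrite rmorphM; congr (_ * _); rewrite /Qadj /Qop /bavg rmorphM rmorph_sum /=; congr (_ * _).
  by rewrite -[toC _]/(_%:C) natrX exprM.
- rewrite /neumann_lap eta_inv exprVn invrK -mulrN -sumrN rmorph_sum /= mulr_sumr.
  apply: eq_bigr => mu _; rewrite nval_plus nval_minus /lap.
  rewrite !(rmorphM, rmorphB) /= rmorph_nat.
  rewrite -[toC _]/(_%:C) rmorphXn /= rmorph_nat; ring.
Qed.

Lemma Amat_real : Amat d (L ^ m) a mu0 L k = map_mx (real_complex R) (opmat A).
Proof.
apply/matrixP => i j; rewrite !mxE -Aop_real; congr (Aop _ _ _ _ _ _).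
by apply/funext => y; rewrite /delta_fn /delta; case: eqP.
Qed.

Lemma GkE (f : T -> R[i]) x :
  Gk a mu0 L k f x =
  \sum_(j < #|{: T}|) (invmx (opmat A) (enum_rank x) j)%:C * f (enum_val j).
Proof.
by rewrite /Gk Amat_real -map_invmx; apply: eq_bigr => j _; rewrite mxE.
Qed.

Lemma finlinear_Areal : finlinear A.
Proof.
move=> f x; rewrite /Areal.
rewrite [RHS](eq_bigr (fun y => \sum_mu f y * lap (L ^ k) mu (delta R y) x +
   mubar_j mu0 L k * (f y * delta R x y) +
   a_j a L k * (f y * bavg (L ^ k) (delta R y) x))); last first.
  move=> y _; rewrite !mulrDr mulr_sumr /delta (eq_sym y x).
  by congr (_ + _ + _); rewrite mulrCA.
rewrite !big_split /= exchange_big /=; congr (_ + _ + _).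
- by apply: eq_bigr => mu _; rewrite finlinear_lap.
- by rewrite -mulr_sumr sum_delta.
rewrite -mulr_sumr; congr (_ * _); rewrite /bavg.
under [RHS]eq_bigr do rewrite mulrCA.
rewrite -[RHS]mulr_sumr; congr (_ * _).
under [RHS]eq_bigr do rewrite mulr_sumr.
rewrite [RHS](exchange_big_dep (same_block (L ^ k) x)) //=; apply: eq_bigr => z xz.
rewrite -[LHS]sum_delta; apply: eq_big => [y|y _]; first by rewrite xz.
by rewrite /delta eq_sym.
Qed.

(** From [L >= 2] and [k >= 1], the ratio [a_k / a] lies between [3 / 4] and 1. *)
Lemma a_j_bounds : 0 < a -> a <= 1 -> a / 2 <= a_j a L k <= 1.
Proof.
move=> a0 a1; have L2 : 2 <= L%:R :> R by rewrite ler_nat.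
have L0 : 0 < L%:R :> R by lra.
have L1 : 1 < L%:R :> R by lra.
have p4 : L%:R ^- 2 <= 1 / 4 :> R.
  have -> : 1 / 4 = 2 ^- 2 :> R by field.
  by rewrite lef_pV2 ?posrE ?exprn_gt0 // ler_pXn2r ?nnegrE.
have q0 : 0 < L%:R ^- (2 * k) :> R by rewrite invr_gt0 exprn_gt0.
have qp : L%:R ^- (2 * k) <= L%:R ^- 2 :> R.
  by rewrite lef_pV2 ?posrE ?exprn_gt0 // ler_weXn2l ?leq_pmulr // ltW.
rewrite /a_j; set p := L%:R ^- 2 in p4 qp *; set q := L%:R ^- (2 * k) in q0 qp *.
by rewrite ler_pdivlMr ?ler_pdivrMr; [apply/andP; split; nra | lra | lra].
Qed.

Lemma mubar_ge0 : 0 <= mu0 -> 0 <= mubar_j mu0 L k.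
Proof. by move=> h; rewrite mulr_ge0 ?exprn_ge0 ?ler0n. Qed.

Lemma dist_supp_le (f : T -> R[i]) x y : f y != 0 ->
  dist_supp L k x f <=
    (L ^ k)%:R^-1 * Num.sqrt (\sum_mu ((x mu)%:R - (y mu)%:R) ^+ 2).
Proof.
by move=> fy; rewrite -eta_inv; exact: (bigmin_le_cond _ (P := fun z => f z != 0) (Defs.edist R L k x) fy).
Qed.

Lemma normc_le_supnorm (f : T -> R[i]) x : normc (f x) <= supnorm f.
Proof. exact: (le_bigmax _ (fun x => normc (f x))). Qed.

(** Against the row of the real inverse at [x], complex data is replaced by its modulus times the
    sign of the entry. This real datum [h] can only increase the modulus at [x], while its sup norm
    and support are controlled by those of [f]. *)
Lemma Gk_bound (f : T -> R[i]) x : (0 < d)%N -> 0 < a <= 1 -> 0 <= mu0 ->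
  normc (Gk a mu0 L k f x) <=
  4 ^+ d * ((1 + Kc d a) + d%:R * (3 + 2 * Kc d a)) * supnorm f *
    expR (- (rate d a / 2) * dist_supp L k x f).
Proof.
move=> d0 a01 mu00; have /andP[a0 a1] := a01.
have n0 : (0 < L ^ k)%N by rewrite expn_gt0 (ltnW L_gt1).
have nN : (L ^ k %| L ^ m)%N by rewrite dvdn_exp2l.
have bound := solution_bound d0 n0 nN a01 (a_j_bounds a0 a1) (mubar_ge0 mu00).
(* Injectivity comes from the a priori bound itself, taken with zero data. *)
have injA (v : T -> R) : (forall y, A v y = 0) -> forall y, v y = 0.
  move=> Av y; apply/eqP; rewrite -normr_le0.
  have := bound v y 0 0; rewrite mulr0 mul0r; apply => z; first by rewrite Av normr0.
  by rewrite Av eqxx.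
pose M j := invmx (opmat A) (enum_rank x) j.
pose h y := Num.sg (M (enum_rank y)) * normc (f y).
have Au : A (invop A h) = h := invopK h finlinear_Areal injA.
have Gk_le : normc (Gk a mu0 L k f x) <= `|invop A h x|.
  rewrite GkE; apply: le_trans (le_normc_sum _) (le_trans _ (ler_norm _)).
  rewrite /invop; apply: ler_sum => j _.
  rewrite ComplexField.Normc.normcM normc_real /h enum_valK mulrA.
  by rewrite -/(M j) [M j * _]mulrC -normrEsg.
apply: le_trans Gk_le (bound _ x _ _ _ _) => y; rewrite Au /h.
  apply: le_trans (normc_le_supnorm f y); rewrite normrM (ger0_norm (normc_ge0 _)).
  by rewrite ler_piMl ?normc_ge0 // normr_sg lern1 leq_b1.
move=> hy; apply: dist_supp_le; apply: contraNneq hy => ->.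
by rewrite ComplexField.Normc.normc0 mulr0.
Qed.

End ComplexToReal.

Theorem theoremA (R : realType) (d : nat) (a : R) :
  (1 <= d)%N -> 0 < a <= 1 ->
  exists c c1 : R, 0 < c /\ 0 < c1 /\
    forall (L k m : nat) (mu0 : R) (f : Pt d (L ^ m) -> R[i]) (x : Pt d (L ^ m)),
      odd L -> (1 < L)%N -> (1 <= k)%N -> (k <= m)%N -> 0 <= mu0 ->
      ComplexField.Normc.normc (Gk a mu0 L k f x)
        <= c * (L%:R : R) ^+ (2 * d) * expR (- c1 * dist_supp L k x f)
           * supnorm f.
Proof.
move=> d0 a01; have r0 := rate_gt0 d0 a01; have K0 := Kc_ge0 d0 a01.
have c0 : 0 < 4 ^+ d * ((1 + Kc d a) + d%:R * (3 + 2 * Kc d a)).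
  rewrite mulr_gt0 ?exprn_gt0 // ltr_pwDl ?mulr_ge0 ?ler0n //; lra.
exists (4 ^+ d * ((1 + Kc d a) + d%:R * (3 + 2 * Kc d a))), (rate d a / 2).
split=> //; split; first by rewrite divr_gt0.
move=> L k m mu0 f x _ L1 k1 km mu00.
apply: le_trans (Gk_bound L1 k1 km f x d0 a01 mu00) _.
set C := 4 ^+ d * _ in c0 *; set E := expR _; set S := supnorm f.
have S0 : 0 <= S := le_trans (normc_ge0 (f x)) (normc_le_supnorm f x).
have -> : C * L%:R ^+ (2 * d) * E * S = L%:R ^+ (2 * d) * (C * S * E) by ring.
rewrite ler_peMl //; last by rewrite exprn_ege1 // ler1n ltnW.
by apply: mulr_ge0; [exact: mulr_ge0 (ltW c0) S0 | exact: expR_ge0].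
Qed.
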